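(* Fix $k\in\mathbb N$. For each integer $n\ge k$ let $X^{(n)}$ be a random vector in $\mathbb R^n$ and let $\mathbf A_{n,k}$ be a random $n\times k$ matrix distributed according to the Haar measure on the Stiefel manifold $\mathbb V_{n,k}$, independent of $X^{(n)}$. Suppose that one of the following two assumptions holds for a positive sequence $\{s_n\}$ and a good rate function $J_X:\mathbb R\to[0,\infty]$: (A* ) $s_n=n$ for all $n$, and $\{\|X^{(n)}\|_2/\sqrt n\}_n$ satisfies an LDP in $\mathbb R$ at speed $s_n=n$ with GRF $J_X$; (B) $s_n\to\infty$, $n/s_n\to\infty$, and $\{\sqrt{s_n}\,\|X^{(n)}\|_2/n\}_n$ satisfies an LDP in $\mathbb R$ at speed $s_n$ with GRF $J_X$. Then $\{n^{-1/2}\mathbf A_{n,k}^TX^{(n)}\}_n$ satisfies an LDP in $\mathbb R^k$ at speed $s_n$ with GRF $I_{\mathbf AX,k}:\mathbb R^k\to[0,\infty]$ defined, for $x\in\mathbb R^k$, by $$I_{\mathbf AX,k}(x)=\begin{cases}\inf_{0<c<1}\left\{J_X\left(\frac{\|x\|_2}{c}\right)-\frac12\log(1-c^2)\right\},&\text{if (A* ) holds},\\[4pt] \inf_{c>0}\left\{J_X\left(\frac{\|x\|_2}{c}\right)+\frac{c^2}{2}\right\},&\text{if (B) holds}.\end{cases}$$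
   Context: Stiefel manifold: $\mathbb V_{n,k}=\{A\in\mathbb R^{n\times k}:A^TA=I_k\}$; its Haar measure is the unique probability measure on $\mathbb V_{n,k}$ invariant under orthogonal transformations. $\|\cdot\|_2$ is the Euclidean norm. LDP: a sequence of random variables $\{\eta_n\}$ with values in a regular topological space $\mathcal X$ satisfies a large deviation principle (LDP) at speed $s_n$ with rate function $I:\mathcal X\to[0,\infty]$ if $I$ is lower semicontinuous and for every Borel set $\Gamma$, $-\inf_{\Gamma^\circ}I\le\liminf_n\frac1{s_n}\log\mathbb P(\eta_n\in\Gamma)\le\limsup_n\frac1{s_n}\log\mathbb P(\eta_n\in\Gamma)\le-\inf_{\bar\Gamma}I$. It is a good rate function (GRF) if moreover its level sets are compact.
   Formalization: The rate function is set to 0 at x = 0; the printed formula gives J_X(0) there, which fails lower semicontinuity when J_X(0) > 0 (e.g. ‖X^(n)‖ = √n), and the two agree when J_X(0) = 0. *)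

(* Defs.v *)
From HB Require Import structures.
From mathcomp Require Import all_boot all_order all_algebra.
From mathcomp Require Import all_classical all_reals all_analysis.

Set Implicit Arguments.
Unset Strict Implicit.
Unset Printing Implicit Defensive.

Import Order.TTheory GRing.Theory Num.Theory.
Import numFieldNormedType.Exports.

Local Open Scope classical_set_scope.
Local Open Scope ring_scope.

Definition borelType (S : ptopologicalType) := g_sigma_algebraType (@open S).

Definition borel (S : ptopologicalType) (B : set S) : Prop :=
  measurable (B : set (borelType S)).

Definition random_element d (T : measurableType d) (S : ptopologicalType)
    (f : T -> S) : Prop :=
  measurable_fun setT (f : T -> borelType S).

Definition law d (T : measurableType d) (R : realType) (P : probability T R)
    (S : ptopologicalType) (f : T -> S) : set S -> \bar R :=
  pushforward P (f : T -> borelType S).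

Definition independent d (T : measurableType d) (R : realType)
    (P : probability T R) (S S' : ptopologicalType)
    (f : T -> S) (g : T -> S') : Prop :=
  forall (B : set S) (C : set S'), borel B -> borel C ->
    P ((f @^-1` B) `&` (g @^-1` C)) = (P (f @^-1` B) * P (g @^-1` C))%E.

Definition enorm2 (R : realType) (n : nat) (x : 'cV[R]_n) : R :=
  Num.sqrt (\sum_(i < n) x i 0 ^+ 2).

Definition stiefel (R : realType) (n k : nat) : set 'M[R]_(n, k) :=
  [set A | A^T *m A = 1%:M].

(* [mu] is seen as a measure on the ambient space of matrices, carried by the
   Stiefel manifold; O(n) acts by multiplication on the left. *)
Definition stiefel_haar (R : realType) (n k : nat)
    (mu : set 'M[R]_(n, k) -> \bar R) : Prop :=
  mu (@stiefel R n k) = 1%E /\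
  forall (O : 'M[R]_n), O^T *m O = 1%:M ->
  forall (B : set 'M[R]_(n, k)), borel B -> mu (mulmx O @^-1` B) = mu B.

(* The variables [eta n] may live on different probability spaces.  Only the
   behaviour for large [n] matters, so that the families below, which the
   hypotheses constrain for [k <= n] only, can be indexed by all of [nat]. *)
Definition LDP (R : realType) (d : nat -> measure_display)
    (T : forall n, measurableType (d n)) (P : forall n, probability (T n) R)
    (S : ptopologicalType) (eta : forall n, T n -> S)
    (s : nat -> R) (I : S -> \bar R) : Prop :=
  [/\ forall x, (0 <= I x)%E,
      lower_semicontinuous I &
      forall G : set S, borel G ->
        let u n := (((s n)^-1)%:E * lne (P n (eta n @^-1` G)))%E in
        [/\ (- ereal_inf (I @` interior G) <= limn_einf u)%E,
            (limn_einf u <= limn_esup u)%E &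
            (limn_esup u <= - ereal_inf (I @` closure G))%E]].

Definition good_rate (R : realType) (S : ptopologicalType) (I : S -> \bar R)
    : Prop :=
  forall a : R, compact [set x | (I x <= a%:E)%E].

Definition LDP_good (R : realType) (d : nat -> measure_display)
    (T : forall n, measurableType (d n)) (P : forall n, probability (T n) R)
    (S : ptopologicalType) (eta : forall n, T n -> S)
    (s : nat -> R) (I : S -> \bar R) : Prop :=
  LDP P eta s I /\ good_rate I.

Definition assumption_Astar (R : realType) (k : nat)
    (d : nat -> measure_display)
    (T : forall n, measurableType (d n)) (P : forall n, probability (T n) R)
    (X : forall n, T n -> 'cV[R]_n) (s : nat -> R) (J : R -> \bar R) : Prop :=
  (forall n, (k <= n)%N -> s n = n%:R) /\
  LDP_good P (fun n t => enorm2 (X n t) / Num.sqrt n%:R : R) s J.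

Definition assumption_B (R : realType)
    (d : nat -> measure_display)
    (T : forall n, measurableType (d n)) (P : forall n, probability (T n) R)
    (X : forall n, T n -> 'cV[R]_n) (s : nat -> R) (J : R -> \bar R) : Prop :=
  [/\ s n @[n --> \oo] --> +oo,
      n%:R / s n @[n --> \oo] --> +oo &
      LDP_good P (fun n t => Num.sqrt (s n) * enorm2 (X n t) / n%:R : R) s J].

(* In both rate functions the infimum is the cost of a factorization
   |x| = c * r, where c is the norm of the projection of a unit vector and r
   the rescaled norm of X.  For x != 0 this forces c > 0 and r = |x| / c.  For
   x = 0 the choice c = 0 leaves r free, and the cost is inf J = 0.  The
   infimum over c > 0 alone would give J 0 at the origin: this is the same
   number when J 0 = 0, but otherwise (for instance when |X^(n)| = sqrt n, so
   that J is 0 at 1 and +oo elsewhere) it is not a lower semicontinuous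
   function of x, hence not a rate function. *)
Definition rate_Astar (R : realType) (k : nat) (J : R -> \bar R)
    (x : 'cV[R]_k) : \bar R :=
  if x == 0 then 0%E else
  ereal_inf [set (J (enorm2 x / c)%R - (2^-1 * ln (1 - c ^+ 2))%:E)%E
            | c in [set c : R | 0 < c < 1]].

Definition rate_B (R : realType) (k : nat) (J : R -> \bar R)
    (x : 'cV[R]_k) : \bar R :=
  if x == 0 then 0%E else
  ereal_inf [set (J (enorm2 x / c)%R + (c ^+ 2 / 2)%:E)%E
            | c in [set c : R | 0 < c]].

(* Main.v *)
Require Import Defs.
From HB Require Import structures.
From mathcomp Require Import all_boot all_order all_algebra.
From mathcomp Require Import all_classical all_reals all_analysis.
From mathcomp Require Import measurable_realfun ring lra zify.

Set Implicit Arguments.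
Unset Strict Implicit.
Unset Printing Implicit Defensive.

Import Order.TTheory GRing.Theory Num.Theory.
Import numFieldNormedType.Exports.

Local Open Scope classical_set_scope.
Local Open Scope ring_scope.

(* For a unit vector u, the vector Z = A^T u has a law which does not depend on
   u, so that A^T X is the product of the two independent variables |X| and Z.
   The squared norm V = |A^T u|^2 is a squared row norm of a Haar matrix; its
   moments follow from rotation invariance alone, by expanding
   E (w^T A A^T w)^m = |w|^(2m) E V^m to second order around a basis vector:
   E V^m = \prod_(j < m) (k + 2 j) / (n + 2 j).
   Markov's inequality with an inverse power of 1 - l V bounds the tails of |Z|
   from above. For k = 1, concentration of V under the measure V^m dmu bounds
   the tails of a single coordinate of Z from below; together with the upper
   bound on |Z| this forces Z into any given small ball.
   In both regimes P (|tau_n Z| >= g y) is exp(- s_n (y + o(1))), with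
   tau_n = 1, g y = sqrt (1 - exp (- 2 y)) under (A* ) and
   tau_n = sqrt (n / s_n), g y = sqrt (2 y) under (B), and the rate function is
   the infimum over y > 0 of J (|x| / g y) + y. The LDP of the product is
   obtained by cutting the range of the two factors into small cells. *)

(** * Moments and binomial series *)

(** The Haar measure is available only through its invariance: there is no density to integrate, so
    every estimate has to come from integer moments. For n > k these are the moments of a Beta
    variable with parameters k/2 and (n-k)/2, for which E (1 - l V)^(-n/2) = (1 - l)^(-k/2), a value
    free of n. This is why an inverse power, and not an exponential, is the right test function: as
    l tends to 1 it bounds P (V >= c^2) by (1 - c^2)^(n/2) up to an arbitrarily small loss in the
    rate, hence the term - (1/2) log (1 - c^2). Only integer powers are used; rounding n/2 costs a
    bounded factor. From below, tilting by V^m moves the mean of V to about 2m/(n + 2m), and m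
    proportional to s_n puts it at the wanted level; an elementary bound on binomial coefficients
    plays the role of Stirling's formula. A direction is needed besides a radius: among the points z
    with <z, v> >= c the cheapest is c v, and the part of this half-space with |z| < c' lies close
    to c v when c' is close to c. *)

Definition negbin (R : realType) (v : nat) (x : R) (N : nat) : R :=
  \sum_(m < N) 'C(v + m, m)%:R * x ^+ m.

(** [negbin v x N] is the series of (1 - x)^-(v+1) cut after N terms. Pascal's rule makes
    multiplication by 1 - x lower the exponent by one, up to one boundary term. *)
Lemma negbinS (R : realType) (v : nat) (x : R) (N : nat) :
  (1 - x) * negbin v.+1 x N.+1 =
  negbin v x N.+1 - 'C(v.+1 + N, N)%:R * x ^+ N.+1.
Proof.
rewrite /negbin; elim: N => [|N IH].
  by rewrite !big_ord_recr !big_ord0 /= !addn0 !bin0 !expr0 expr1; ring.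
rewrite big_ord_recr /= mulrDr IH [in RHS]big_ord_recr /=.
have -> : 'C(v.+1 + N.+1, N.+1) = ('C(v + N.+1, N.+1) + 'C(v.+1 + N, N))%N.
  by rewrite addSn binS addnS addSn.
by rewrite natrD !exprS; ring.
Qed.

Lemma negbin0 (R : realType) (x : R) (N : nat) :
  (1 - x) * negbin 0 x N = 1 - x ^+ N.
Proof.
rewrite /negbin; under eq_bigr do rewrite add0n binn mul1r.
by have := subrXX 1 x N; rewrite expr1n => ->; under [in RHS]eq_bigr do rewrite expr1n mul1r.
Qed.

Lemma negbin_ge0 (R : realType) (v : nat) (x : R) (N : nat) :
  0 <= x -> 0 <= negbin v x N.
Proof. by move=> x0; apply: sumr_ge0 => i _; rewrite mulr_ge0// exprn_ge0. Qed.

(** Each factor 1 - x lowers v by one and drops a nonnegative boundary term, down to the geometric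
    sum. *)
Lemma negbin_le (R : realType) (v : nat) (x : R) (N : nat) :
  0 <= x <= 1 -> (1 - x) ^+ v.+1 * negbin v x N <= 1.
Proof.
move=> /andP[x0 x1]; elim: v N => [|v IH] N.
  by rewrite expr1 negbin0 gerBl exprn_ge0.
case: N => [|N]; first by rewrite /negbin big_ord0 mulr0.
rewrite exprSr -mulrA negbinS mulrBr lerBlDr (le_trans (IH _))// lerDl.
by rewrite !mulr_ge0// ?exprn_ge0// subr_ge0.
Qed.

Lemma bin_le_negbin (R : realType) (v m : nat) (x : R) : 0 <= x <= 1 ->
  (1 - x) ^+ v.+1 * ('C(v + m, m)%:R * x ^+ m) <= 1.
Proof.
move=> /[dup] x01 /andP[x0 x1]; apply: le_trans (negbin_le v m.+1 x01).
rewrite ler_wpM2l ?exprn_ge0 ?subr_ge0// /negbin big_ord_recr /= lerDr.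
exact: negbin_ge0.
Qed.

(** For x < y < 1, a single term of the series at y is bounded by (1 - y)^-(v+1), which leaves the
    geometric factor (x / y)^n. *)
Lemma bin_geometric_cvg0 (R : realType) (v : nat) (x : R) : 0 <= x < 1 ->
  ('C(v + n, n)%:R * x ^+ n) @[n --> \oo] --> (0 : R).
Proof.
move=> /andP[x0 x1].
have [y [y0 y1 xy]] : exists y, [/\ 0 < y, y < 1 & x < y].
  by exists ((1 + x) / 2); split; lra.
have K0 : 0 < (1 - y) ^+ v.+1 by rewrite exprn_gt0// subr_gt0.
pose K := ((1 - y) ^+ v.+1)^-1.
have bnd n : 'C(v + n, n)%:R * x ^+ n <= K * (x / y) ^+ n.
  rewrite -[leLHS]mulr1 -[X in _ * X](@divff _ (y ^+ n)) ?gt_eqF ?exprn_gt0//.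
  rewrite expr_div_n mulrACA ler_wpM2r ?divr_ge0 ?exprn_ge0 ?(ltW y0)//.
  by rewrite /K -[leRHS]mul1r ler_pdivlMr// mulrC bin_le_negbin// !ltW.
apply: (@squeeze_cvgr _ _ _ _ (cst 0) (fun n => K * (x / y) ^+ n)).
- by near=> n; rewrite /= bnd andbT mulr_ge0// exprn_ge0.
- exact: cvg_cst.
- have : (K * (x / y) ^+ n) @[n --> \oo] --> (K * 0 : R); last by rewrite mulr0.
  apply: cvgM; first exact: cvg_cst.
  apply: (@cvg_expr _ (x / y)); rewrite ger0_norm ?divr_ge0 ?(ltW y0)//.
  by rewrite ltr_pdivrMr// mul1r.
Unshelve. all: by end_near. Qed.

Lemma negbin_cvg (R : realType) (v : nat) (x : R) : 0 <= x < 1 ->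
  ((1 - x) ^+ v.+1 * negbin v x n) @[n --> \oo] --> (1 : R).
Proof.
move=> /[dup] x01 /andP[x0 x1]; elim: v => [|v IH].
  under eq_cvg do rewrite expr1 negbin0.
  have : (1 - x ^+ n) @[n --> \oo] --> (1 - 0 : R).
    by apply: cvgB; [exact: cvg_cst|apply: (@cvg_expr _ x); rewrite ger0_norm].
  by rewrite subr0.
apply/cvgrPdist_lt => /= e e0.
pose r (n : nat) : R := (1 - x) ^+ v.+1 * x * ('C(v.+1 + n, n)%:R * x ^+ n).
have rC : r n @[n --> \oo] --> (0 : R).
  have : r n @[n --> \oo] --> ((1 - x) ^+ v.+1 * x * 0 : R); last by rewrite mulr0.
  by apply: cvgM; [exact: cvg_cst|exact: bin_geometric_cvg0].
have : ((1 - x) ^+ v.+1 * negbin v x n.+1 - r n) @[n --> \oo] --> (1 - 0 : R).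
  by apply: cvgB rC; move: IH; rewrite -cvg_shiftS.
rewrite subr0 => /cvgrPdist_lt /(_ e e0) [N _ HN]; exists N.+1 => // -[//|n] /= Nn.
have := HN n Nn; congr (`|1 - _| < e).
by rewrite [in RHS]exprSr -mulrA negbinS /r [x ^+ n.+1]exprS; ring.
Qed.

(* The [m]-th moment of the squared norm of a row of a uniform point of the
   Stiefel manifold. *)
Definition stiefel_moment (R : realType) (k n m : nat) : R :=
  \prod_(j < m) ((k + 2 * j)%:R / (n + 2 * j)%:R).

Lemma stiefel_momentS (R : realType) (k n m : nat) :
  stiefel_moment R k n m.+1 =
  stiefel_moment R k n m * ((k + 2 * m)%:R / (n + 2 * m)%:R).
Proof. by rewrite /stiefel_moment big_ord_recr. Qed.

Lemma stiefel_moment_gt0 (R : realType) (k n m : nat) :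
  (0 < k)%N -> (0 < n)%N -> 0 < stiefel_moment R k n m.
Proof.
by move=> k0 n0; apply: prodr_gt0 => i _; rewrite divr_gt0 ?ltr0n ?addn_gt0 ?k0 ?n0.
Qed.

Lemma bin_prod (R : realType) (v m : nat) :
  'C(v + m, m)%:R = \prod_(j < m) ((v.+1 + j)%:R / j.+1%:R) :> R.
Proof.
elim: m => [|m IH]; first by rewrite addn0 bin0 big_ord0.
rewrite big_ord_recr /= -IH.
apply: (@mulIf _ m.+1%:R); first by rewrite pnatr_eq0.
rewrite -mulrA mulfVK ?pnatr_eq0// -!natrM; congr (_%:R).
by rewrite addnS mulnC -mul_bin_diag mulnC addSn.
Qed.

(** True factor by factor, as 2 (v + 1 + j) <= n + 2 j and k + 1 + 2 j <= 2 (k + 1 + j). Summed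
    against l^m, it bounds the mean of (1 - l V)^-(v+1) by (1 - l)^-(k+1) uniformly in n; the number
    of columns is [k.+1] here. *)
Lemma bin_stiefel_moment_le (R : realType) (v k n m : nat) :
  (2 * v.+1 <= n)%N ->
  'C(v + m, m)%:R * stiefel_moment R k.+1 n m <= 'C(k + m, m)%:R.
Proof.
move=> vn; rewrite !bin_prod /stiefel_moment -big_split /=.
apply: ler_prod => j _; apply/andP; split.
  by rewrite !mulr_ge0// ?invr_ge0.
rewrite mulrAC ler_wpM2r ?invr_ge0// mulrA ler_pdivrMr; last by rewrite ltr0n; lia.
by rewrite -!natrM ler_nat; nia.
Qed.

(** Replacing n by 2 (v + 1) bounds the moment from below by a central binomial quotient divided by
    'C(v + m + 1, m + 1), and one term of the negative binomial series bounds the inverse of that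
    coefficient. The parameter x is free; it is later set to the tilted mean. *)
Lemma stiefel_moment1_ge (R : realType) (v n m : nat) (x : R) :
  (0 < n)%N -> (n <= 2 * v.+1)%N -> 0 <= x <= 1 ->
  x ^+ m.+1 * (1 - x) ^+ v.+1 / (2 * m.+1%:R) <= stiefel_moment R 1 n m.+1.
Proof.
move=> n0 nv x01.
have C0 : 0 < 'C(v + m.+1, m.+1)%:R :> R by rewrite ltr0n bin_gt0 leq_addl.
(* The product is 'C(2m + 2, m + 1) / 4^(m+1). A crude bound is enough, since polynomial factors do
   not affect rates. *)
have central : (2 * m.+1%:R)^-1 <=
    \prod_(j < m.+1) ((1 + 2 * j)%:R / (2 * j.+1%:R)) :> R.
  elim: m {C0} => [|m IH]; first by rewrite big_ord_recr big_ord0 /= mul1r mulr1 muln0 addn0 mul1r.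
  rewrite big_ord_recr /=; apply: le_trans (ler_wpM2r _ IH); last first.
    by rewrite divr_ge0.
  rewrite -natrM mulrC -mulrA -invfM -natrM ler_pdivlMr ?ltr0n//.
  by rewrite -natrM mulrC ler_pdivrMr ?ltr0n// -natrM ler_nat; nia.
have : 'C(v + m.+1, m.+1)%:R^-1 * (2 * m.+1%:R)^-1 <= stiefel_moment R 1 n m.+1.
  apply: le_trans (ler_wpM2l _ central) _; first by rewrite invr_ge0 ltW.
  rewrite bin_prod -prodfV -big_split /=; apply: ler_prod => j _.
  apply/andP; split; first by rewrite mulr_ge0 ?invr_ge0 ?mulr_ge0// ?invr_ge0.
  rewrite invf_div mulrCA ler_wpM2l//.
  have cancel (a b : R) : a != 0 -> b != 0 -> a / b / (2 * a) = (2 * b)^-1.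
    by move=> a0 b0; field; rewrite a0 b0.
  rewrite cancel ?pnatr_eq0//.
  by rewrite -natrM lef_pV2 ?posrE ?ltr0n// ?ler_nat; lia.
apply: le_trans; rewrite ler_wpM2r ?invr_ge0//.
rewrite -[leRHS]mul1r ler_pdivlMr//.
by have := bin_le_negbin v m.+1 x01; congr (_ <= _); ring.
Qed.

(** * Borel sets of matrices *)

Lemma borel_open (S : ptopologicalType) (U : set S) : open U -> borel U.
Proof. exact: sub_sigma_algebra. Qed.

Lemma borel_closed (S : ptopologicalType) (U : set S) : closed U -> borel U.
Proof.
move=> cU; rewrite -[U]setCK; apply: (@measurableC _ (borelType S)).
by apply: borel_open; exact: closed_openC.
Qed.

Lemma continuous_borel_measurable (R : realType) (S : ptopologicalType)
    (f : S -> R) :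
  continuous f -> measurable_fun setT (f : borelType S -> R).
Proof.
move=> cf; apply: (measurability _ (RGenOInfty.measurableE R)) => //.
move=> _ [_ [x ->] <-]; rewrite setTI; apply: borel_open.
by apply: open_comp => // y _; exact: cf.
Qed.

Lemma mx_box_open (R : realType) (n k : nat) (U : set 'M[R]_(n, k)) (M : 'M[R]_(n, k)) :
  open U -> U M -> exists2 e : R, 0 < e &
    forall N : 'M[R]_(n, k), (forall i j, `|M i j - N i j| < e) -> U N.
Proof.
rewrite openE => oU /oU; rewrite /interior => /nbhs_ballP[e /= e0 eU].
by exists e => // N MN; apply: eU; split.
Qed.

(** The Borel sets are generated by all open sets, so an open set is written as a countable union of
    boxes with rational centres and radii 1 / (N + 1), each cut out by finitely many coordinates. *)
Lemma random_element_mx d (T : measurableType d) (R : realType) (n k : nat)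
    (f : T -> 'M[R]_(n, k)) :
  (forall i j, measurable_fun setT (fun t => f t i j)) -> random_element f.
Proof.
move=> mf; apply: (@measurability _ _ T (borelType 'M[R]_(n, k)) setT f open) => //.
move=> _ [U oU <-]; rewrite setTI.
pose box (M : 'M[rat]_(n, k)) (N : nat) : set 'M[R]_(n, k) :=
  [set A | forall i j, `|ratr (M i j) - A i j| < N.+1%:R^-1].
pose I := ('M[rat]_(n, k) * nat)%type.
have -> : f @^-1` U = \bigcup_(m in [set m : nat | exists2 p : I,
    unpickle m = Some p & box p.1 p.2 `<=` U])
    f @^-1` (if unpickle m is Some p then box p.1 p.2 else set0).
  apply/seteqP; split => [t Uft|t [m [p pm pU]]]; last first.
    by rewrite pm /= => /pU.
  have [e e0 eU] := mx_box_open oU Uft.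
  have [N] : exists N : nat, N.+1%:R^-1 < e / 2.
    exists (Num.trunc (e / 2)^-1); rewrite invf_plt ?posrE ?divr_gt0//.
    exact: truncnS_gt.
  move=> Ne.
  have /choice[q qP] (p : 'I_n * 'I_k) :
      exists q : rat, `|ratr q - f t p.1 p.2| < N.+1%:R^-1.
    case: p => i j /=; have [|q] := @rat_in_itvoo R (f t i j - N.+1%:R^-1) (f t i j + N.+1%:R^-1).
      by rewrite ltrBlDr -addrA ltrDl addr_gt0.
    rewrite in_itv /= => /andP[h1 h2]; exists q.
    by rewrite ltr_norml ltrBrDl h1 ltrBlDl h2.
  pose M := \matrix_(i < n, j < k) q (i, j).
  have MP i j : `|ratr (M i j) - f t i j| < N.+1%:R^-1.
    by rewrite mxE; exact: qP (i, j).
  exists (pickle (M, N)); last by rewrite /= pickleK /=.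
  exists (M, N); first by rewrite pickleK.
  move=> A AP; apply: eU => i j.
  rewrite -[X in `|X|](subrKA (ratr (M i j))) (le_lt_trans (ler_normD _ _))//.
  by rewrite [e]splitr ltrD// (lt_trans _ Ne)// 1?distrC ?MP//; exact: AP.
apply: bigcup_measurable => m _; case: (unpickle m) => [[M N]|]; last first.
  by rewrite preimage_set0; exact: measurable0.
have -> : f @^-1` box M N = \bigcap_(i in [set: 'I_n]) \bigcap_(j in [set: 'I_k])
    (fun t => f t i j) @^-1` [set x | `|ratr (M i j) - x| < N.+1%:R^-1].
  apply/seteqP; split => t /=; first by move=> h i _ j _; exact: h.
  by move=> h i j; exact: h.
apply: fin_bigcap_measurable => // i _; apply: fin_bigcap_measurable => // j _.
rewrite -[X in measurable X]setTI; apply: mf => //.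
exact: (measurable_ball (ratr (M i j) : R) N.+1%:R^-1).
Qed.

Lemma measurable_coord d (T : measurableType d) (R : realType) (n k : nat)
    (f : T -> 'M[R]_(n, k)) (i : 'I_n) (j : 'I_k) :
  random_element f -> measurable_fun setT (fun t => f t i j).
Proof.
move=> mf; have mc := continuous_borel_measurable (@coord_continuous R n k i j).
exact: (measurableT_comp mc mf).
Qed.

Lemma measurable_mulmx d (T : measurableType d) (R : realType) (n k l : nat)
    (f : T -> 'M[R]_(n, k)) (g : T -> 'M[R]_(k, l)) :
  random_element f -> random_element g -> random_element (fun t => f t *m g t).
Proof.
move=> mf mg; apply: random_element_mx => i j.
under eq_fun do rewrite mxE.
by apply: measurable_sum => m; apply: measurable_funM; exact: measurable_coord.
Qed.

Lemma measurable_trmx d (T : measurableType d) (R : realType) (n k : nat)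
    (f : T -> 'M[R]_(n, k)) :
  random_element f -> random_element (fun t => (f t)^T).
Proof.
move=> mf; apply: random_element_mx => i j.
by under eq_fun do rewrite mxE; exact: measurable_coord.
Qed.

Lemma measurable_enorm2 d (T : measurableType d) (R : realType) (n : nat)
    (f : T -> 'cV[R]_n) :
  random_element f -> measurable_fun setT (fun t => enorm2 (f t)).
Proof.
move=> mf; apply: (measurableT_comp (continuous_measurable_fun (@sqrt_continuous R))).
by apply: measurable_sum => i; apply: measurable_funX; exact: measurable_coord.
Qed.

Lemma measurable_scalemx d (T : measurableType d) (R : realType) (n k : nat)
    (a : T -> R) (f : T -> 'M[R]_(n, k)) :
  measurable_fun setT a -> random_element f ->
  random_element (fun t => a t *: f t).
Proof.
move=> ma mf; apply: random_element_mx => i j.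
by under eq_fun do rewrite mxE; apply: measurable_funM => //; exact: measurable_coord.
Qed.

(** * Averages over the Stiefel manifold *)

Lemma random_element_id (R : realType) (n k : nat) :
  random_element (fun A : borelType 'M[R]_(n, k) => A : 'M[R]_(n, k)).
Proof. exact: measurable_id. Qed.

Lemma stiefel_borel (R : realType) (n k : nat) : borel (@stiefel R n k).
Proof.
have -> : @stiefel R n k = \bigcap_(i in [set: 'I_k]) \bigcap_(j in [set: 'I_k])
    (fun A : borelType 'M[R]_(n, k) => (A^T *m A) i j) @^-1` [set (1%:M : 'M[R]_k) i j].
  apply/seteqP; split => A /=; first by move=> h i _ j _; rewrite /= h.
  by move=> h; apply/matrixP => i j; exact: (h i I j I).
apply: fin_bigcap_measurable => // i _; apply: fin_bigcap_measurable => // j _.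
rewrite -[X in measurable X]setTI; apply: (measurable_coord i j _) => //.
apply: measurable_mulmx; last exact: random_element_id.
by apply: measurable_trmx; exact: random_element_id.
Qed.

(** Boundedness is asked on the manifold only, as matrix entries are unbounded on the ambient space.
    The class is closed under polynomial operations, so integrability comes for free. *)
Definition stiefel_fun (R : realType) (n k : nat) (f : 'M[R]_(n, k) -> R) : Prop :=
  measurable_fun setT (f : borelType 'M[R]_(n, k) -> R) /\
  exists M, forall A, stiefel A -> `|f A| <= M.

Section stiefel_fun.
Context {R : realType} {n k : nat}.
Implicit Types f g : 'M[R]_(n, k) -> R.

Lemma stiefel_fun_cst c : stiefel_fun (fun _ : 'M[R]_(n, k) => c).
Proof. by split; [exact: measurable_cst|exists `|c|]. Qed.

Lemma stiefel_funD f g : stiefel_fun f -> stiefel_fun g ->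
  stiefel_fun (fun A => f A + g A).
Proof.
move=> [mf [M fM]] [mg [N gN]]; split; first exact: measurable_funD.
exists (M + N) => A sA; rewrite (le_trans (ler_normD _ _))// lerD//.
  exact: fM.
exact: gN.
Qed.

Lemma stiefel_funM f g : stiefel_fun f -> stiefel_fun g ->
  stiefel_fun (fun A => f A * g A).
Proof.
move=> [mf [M fM]] [mg [N gN]]; split; first exact: measurable_funM.
exists (M * N) => A sA; rewrite normrM ler_pM//; [exact: fM|exact: gN].
Qed.

Lemma stiefel_funZ c f : stiefel_fun f -> stiefel_fun (fun A => c * f A).
Proof. by move=> sf; apply: stiefel_funM => //; exact: stiefel_fun_cst. Qed.

Lemma stiefel_funX m f : stiefel_fun f -> stiefel_fun (fun A => f A ^+ m).
Proof.
move=> sf; elim: m => [|m IH]; first exact: stiefel_fun_cst.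
by under eq_fun do rewrite exprS; exact: stiefel_funM.
Qed.

Lemma stiefel_fun_sum (I : Type) (r : seq I) (P : pred I)
    (F : I -> 'M[R]_(n, k) -> R) :
  (forall i, stiefel_fun (F i)) ->
  stiefel_fun (fun A => \sum_(i <- r | P i) F i A).
Proof.
move=> sF; elim: r => [|i r IH].
  by under eq_fun do rewrite big_nil; exact: stiefel_fun_cst.
by under eq_fun do rewrite big_cons; case: (P i) => //; exact: stiefel_funD.
Qed.

Lemma stiefel_coord_le1 (A : 'M[R]_(n, k)) i j : stiefel A -> `|A i j| <= 1.
Proof.
move=> /(congr1 (fun M : 'M[R]_k => M j j)); rewrite !mxE eqxx /= => H.
rewrite -(@ler_pXn2r _ 2) ?nnegrE// expr1n real_normK ?num_real//.
rewrite -[leRHS]H (bigD1 i)//= mxE expr2 lerDl; apply: sumr_ge0 => l _.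
by rewrite mxE -expr2 sqr_ge0.
Qed.

Lemma stiefel_fun_coord i j : stiefel_fun (fun A : 'M[R]_(n, k) => A i j).
Proof.
split; last by exists 1 => A; exact: stiefel_coord_le1.
by apply: (measurable_coord i j _) => //; exact: random_element_id.
Qed.

Lemma stiefel_fun_indic (B : set 'M[R]_(n, k)) :
  borel B -> stiefel_fun (\1_B : _ -> R).
Proof.
move=> bB; split; first exact: (@measurable_indic _ (borelType 'M[R]_(n, k))).
by exists 1 => A _; rewrite ger0_norm indicE; case: (_ \in _).
Qed.

Lemma stiefel_mulmx (O : 'M[R]_n) (A : 'M[R]_(n, k)) :
  O^T *m O = 1%:M -> stiefel A -> stiefel (O *m A).
Proof.
by move=> oO sA; rewrite /stiefel /= trmx_mul mulmxA -(mulmxA A^T) oO mulmx1.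
Qed.

Lemma measurable_mulmxl (O : 'M[R]_n) :
  measurable_fun setT (mulmx O : borelType 'M[R]_(n, k) -> borelType 'M[R]_(n, k)).
Proof.
apply: (measurable_mulmx _ (random_element_id (R := R) (n := n) (k := k))).
exact: measurable_cst.
Qed.

End stiefel_fun.

Section stiefel_mean.
Context {R : realType} {n k : nat}.
Variable mu : probability (borelType 'M[R]_(n, k)) R.
Hypothesis haar_mu : stiefel_haar mu.
Implicit Types f g : 'M[R]_(n, k) -> R.

Definition stiefel_mean f : R :=
  \int[mu]_(A in (@stiefel R n k : set (borelType _))) f A.

Let mV : measurable (@stiefel R n k : set (borelType _)) := @stiefel_borel R n k.

Let muV : mu (@stiefel R n k) = 1%E. Proof. by case: haar_mu. Qed.

Lemma stiefel_integrable f : stiefel_fun f ->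
  mu.-integrable (@stiefel R n k : set (borelType _)) (EFin \o f).
Proof.
move=> [mf [M fM]]; apply: measurable_bounded_integrable => //.
- exact: le_lt_trans (probability_le1 mu mV) (ltry _).
- exact: measurable_funTS.
- exists M; split; first exact: num_real.
  by move=> N MN A sA /=; rewrite (le_trans (fM _ sA))// ltW.
Qed.

Lemma stiefel_mean_eq f g : (forall A, stiefel A -> f A = g A) ->
  stiefel_mean f = stiefel_mean g.
Proof. by move=> fg; apply: eq_Rintegral => A /set_mem; exact: fg. Qed.

Lemma stiefel_meanD f g : stiefel_fun f -> stiefel_fun g ->
  stiefel_mean (fun A => f A + g A) = stiefel_mean f + stiefel_mean g.
Proof. by move=> sf sg; apply: RintegralD => //; exact: stiefel_integrable. Qed.

Lemma stiefel_meanZ c f : stiefel_fun f ->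
  stiefel_mean (fun A => c * f A) = c * stiefel_mean f.
Proof. by move=> sf; apply: RintegralZl => //; exact: stiefel_integrable. Qed.

Lemma stiefel_mean_cst c : stiefel_mean (fun=> c) = c.
Proof. rewrite /stiefel_mean Rintegral_cst// -[RHS]mulr1; congr (_ * _).
exact: (congr1 fine muV). Qed.

Lemma stiefel_mean_sum (I : Type) (r : seq I) (P : pred I)
    (F : I -> 'M[R]_(n, k) -> R) :
  (forall i, stiefel_fun (F i)) ->
  stiefel_mean (fun A => \sum_(i <- r | P i) F i A) =
  \sum_(i <- r | P i) stiefel_mean (F i).
Proof.
move=> sF; elim: r => [|i r IH].
  rewrite big_nil -[RHS](stiefel_mean_cst 0).
  by apply: stiefel_mean_eq => A _; rewrite big_nil.
rewrite big_cons -IH; case: ifPn => Pi; last first.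
  by apply: stiefel_mean_eq => A _; rewrite big_cons (negPf Pi).
rewrite -stiefel_meanD//; last exact: stiefel_fun_sum.
by apply: stiefel_mean_eq => A _; rewrite big_cons Pi.
Qed.

Lemma le_stiefel_mean f g : stiefel_fun f -> stiefel_fun g ->
  (forall A, stiefel A -> f A <= g A) -> stiefel_mean f <= stiefel_mean g.
Proof. by move=> sf sg fg; apply: le_Rintegral => //; exact: stiefel_integrable. Qed.

Lemma stiefel_mean_indic (B : set 'M[R]_(n, k)) :
  borel B -> stiefel_mean \1_B = fine (mu B).
Proof.
move=> bB; rewrite /stiefel_mean /Rintegral integral_indic//; congr fine.
have mB : measurable (B : set (borelType _)) by [].
have VC0 : mu (B `\` @stiefel R n k) = 0%E.
  apply/eqP; rewrite eq_le measure_ge0 andbT.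
  have -> : 0%E = mu (~` @stiefel R n k).
    by rewrite probability_setC// muV subee.
  apply: le_measure; rewrite ?inE.
  - exact: measurableD.
  - exact: measurableC.
  - by move=> A [].
rewrite -[in RHS](setUIDK B (@stiefel R n k)) measureU; first last.
- by apply/seteqP; split => A // [[_ ?] []].
- exact: measurableD.
- exact: measurableI.
by rewrite -[LHS]adde0; congr (_ + _)%E; exact/esym.
Qed.

Lemma stiefel_mean_rot (O : 'M[R]_n) f : O^T *m O = 1%:M -> stiefel_fun f ->
  stiefel_mean (fun A => f (O *m A)) = stiefel_mean f.
Proof.
move=> oO sf.
have oO' : O *m O^T = 1%:M by exact: mulmx1C.
pose phi : borelType 'M[R]_(n, k) -> borelType 'M[R]_(n, k) := mulmx O.
have mphi : measurable_fun setT phi := measurable_mulmxl O.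
have VE : phi @^-1` @stiefel R n k = @stiefel R n k.
  apply/seteqP; split => A /= sA; last exact: stiefel_mulmx.
  rewrite -[A]mul1mx -oO -mulmxA; apply: stiefel_mulmx => //.
  by rewrite trmxK.
rewrite /stiefel_mean /Rintegral; congr fine.
have mf : measurable_fun setT (EFin \o f : borelType _ -> _).
  by case: sf => mf _; apply/measurable_EFinP.
have intf : mu.-integrable (phi @^-1` @stiefel R n k) ((EFin \o f) \o phi).
  rewrite VE; apply: (@stiefel_integrable (f \o phi)); split.
    by apply: measurableT_comp mphi; case: sf.
  by have [_ [M fM]] := sf; exists M => A sA; apply: fM; exact: stiefel_mulmx.
have := integral_pushforward mphi mf intf mV.
rewrite VE => <-; apply: eq_measure_integral.
by move=> B mB _; case: haar_mu => _ /(_ O oO B mB).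
Qed.

End stiefel_mean.

(** * Moments of a squared row norm *)

Lemma poly_funext_eq (R : realType) (p q : {poly R}) :
  (forall t, p.[t] = q.[t]) -> p = q.
Proof.
move=> pq; apply/eqP; rewrite -subr_eq0; apply/eqP.
apply: (@roots_geq_poly_eq0 _ _ [seq i%:R | i <- iota 0 (size (p - q))]).
- by apply/allP => x _; rewrite rootE !hornerE pq subrr.
- by rewrite map_inj_uniq ?iota_uniq// => i j /eqP; rewrite eqr_nat => /eqP.
- by rewrite size_map size_iota.
Qed.

Section quad_power.
Context {R : realType} (a b d : R).
Let Q : {poly R} := a%:P + (2 * b) *: 'X + d *: 'X^2.

Let Q0 : Q`_0 = a. Proof. by rewrite !coefE /=; ring. Qed.
Let Q1 : Q`_1 = 2 * b. Proof. by rewrite !coefE /=; ring. Qed.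
Let Q2 : Q`_2 = d. Proof. by rewrite !coefE /=; ring. Qed.

Let coef0_quadX m : (Q ^+ m)`_0 = a ^+ m.
Proof.
elim: m => [|m IH]; first by rewrite !expr0 coef1.
by rewrite exprS coefM big_ord_recr big_ord0 /= add0r subn0 IH Q0 -exprS.
Qed.

Let coef1_quadX m : (Q ^+ m.+1)`_1 = m.+1%:R * a ^+ m * (2 * b).
Proof.
elim: m => [|m IH]; first by rewrite expr1 expr0 Q1; ring.
rewrite exprS coefM !big_ord_recr big_ord0 /= add0r subn0 subnn Q0 Q1 IH.
by rewrite coef0_quadX -[m.+2]addn1 natrD !exprS; ring.
Qed.

(** Either one factor contributes its X^2 term or two factors contribute their X terms. For m = 0
    the truncated exponent [m.-1] is multiplied by 0. *)
Lemma coef2_quadX m : (Q ^+ m.+1)`_2 =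
  m.+1%:R * (a ^+ m * d) + m.+1%:R * (2 * m%:R * (a ^+ m.-1 * b ^+ 2)).
Proof.
elim: m => [|m IH]; first by rewrite expr1 Q2 expr0; ring.
rewrite exprS coefM !big_ord_recr big_ord0 /= add0r subn0 subnn Q0 Q1 Q2 IH.
rewrite coef1_quadX coef0_quadX -[m.+2]addn1 natrD.
by case: m IH => [|m] _ /=; rewrite ?expr0 ?exprS -?[m.+2]addn1 ?natrD; ring.
Qed.

Lemma size_quadX m : (size (Q ^+ m) <= (2 * m).+1)%N.
Proof.
have sQ : (size Q <= 3)%N.
  by apply/leq_sizeP => -[|[|[|j]]]// _; rewrite !coefE /=; ring.
elim: m => [|m IH]; first by rewrite expr0 size_poly1.
rewrite exprS (leq_trans (size_polyMleq _ _))//.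
by move: sQ IH; lia.
Qed.

End quad_power.

Lemma coef2_1DX2 (R : realType) m : ((1 + 'X^2 : {poly R}) ^+ m)`_2 = m%:R.
Proof.
case: m => [|m]; first by rewrite expr0 coef1.
have := @coef2_quadX R 1 0 1 m; rewrite mulr0 scale0r addr0 scale1r => ->.
by rewrite expr1n expr0n /=; ring.
Qed.

(** The Householder reflection in the hyperplane orthogonal to u - e_i0 exchanges the two unit
    vectors; the identity serves when they coincide. *)
Lemma orthogonal_to_unit (R : realType) (n : nat) (i0 : 'I_n) (u : 'cV[R]_n) :
  u^T *m u = 1%:M ->
  exists2 O : 'M[R]_n, O^T *m O = 1%:M & O *m delta_mx i0 0 = u.
Proof.
move=> uu; pose e : 'cV[R]_n := delta_mx i0 0; pose v : 'cV[R]_n := u - e.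
have [v0|v0] := eqVneq v 0.
  exists 1%:M; first by rewrite trmx1 mul1mx.
  by rewrite mul1mx -/e; apply/esym/eqP; rewrite -subr_eq0 -/v v0.
have uE : u^T *m e = (u i0 0)%:M.
  rewrite /e -colE [LHS]mx11_scalar; congr (_%:M); by rewrite !mxE.
have eu : e^T *m u = (u i0 0)%:M.
  by rewrite -[LHS]trmxK trmx_mul trmxK uE tr_scalar_mx.
have ee : e^T *m e = 1%:M.
  by rewrite /e trmx_delta mul_delta_mx; apply/matrixP => i j; rewrite !ord1 !mxE.
pose c : R := 2 - 2 * u i0 0.
have vT : v^T = u^T - e^T by apply/matrixP => i j; rewrite !mxE.
have vv : v^T *m v = c%:M.
  rewrite vT /v mulmxBl !mulmxBr uu uE eu ee /c.
  by rewrite -!raddfB /=; congr (_%:M); ring.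
have c0 : c != 0.
  apply: contra_neq v0 => c0; apply/matrixP => i j; rewrite ord1 [RHS]mxE.
  have : \sum_l v l 0 ^+ 2 = 0.
    have := congr1 (fun M : 'M[R]_1 => M 0 0) vv.
    rewrite c0 mxE [RHS]mxE eqxx mulr1n => vv0; rewrite -[RHS]vv0.
    by apply: eq_bigr => l _; rewrite [v^T _ _]mxE expr2.
  move/eqP; rewrite psumr_eq0 => [|l _]; last exact: sqr_ge0.
  by move=> /allP /(_ i (mem_index_enum _)); rewrite sqrf_eq0 => /eqP.
have ve : v^T *m e = (- (c / 2))%:M.
  rewrite vT mulmxBl uE ee -raddfB /=; congr (_%:M).
  by rewrite /c; field.
pose O : 'M[R]_n := 1%:M - (2 / c) *: (v *m v^T).
have OT : O^T = O by rewrite /O raddfB /= trmx1 linearZ /= trmx_mul trmxK.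
exists O.
  rewrite OT /O mulmxBl mul1mx mulmxBr mulmx1 -scalemxAl -scalemxAr.
  rewrite mulmxA -(mulmxA v) vv mul_mx_scalar -scalemxAl !scalerA.
  have -> : 2 / c * (2 / c * c) = 2 / c + 2 / c by field.
  by rewrite scalerDl opprB addrK subrK.
rewrite /O mulmxBl mul1mx -scalemxAl -mulmxA ve mul_mx_scalar scalerA.
rewrite (_ : _ * _ = -1); last by field.
by rewrite scaleN1r opprK addrC /v subrK.
Qed.

Definition sqnorm (R : realType) (k : nat) (x : 'cV[R]_k) : R :=
  \sum_(l < k) x l 0 ^+ 2.

Lemma sqnormE (R : realType) (k : nat) (x : 'cV[R]_k) :
  sqnorm x = (x^T *m x) 0 0.
Proof. by rewrite mxE; apply: eq_bigr => l _; rewrite mxE expr2. Qed.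

Lemma sqnormZ (R : realType) (k : nat) (a : R) (x : 'cV[R]_k) :
  sqnorm (a *: x) = a ^+ 2 * sqnorm x.
Proof. by rewrite /sqnorm mulr_sumr; apply: eq_bigr => l _; rewrite mxE exprMn. Qed.

Lemma sqnorm_ge0 (R : realType) (k : nat) (x : 'cV[R]_k) : 0 <= sqnorm x.
Proof. by apply: sumr_ge0 => l _; exact: sqr_ge0. Qed.

Lemma sqnorm1_trmx (R : realType) (k : nat) (u : 'cV[R]_k) :
  sqnorm u = 1 -> u^T *m u = 1%:M.
Proof. by move=> u1; rewrite [LHS]mx11_scalar -sqnormE u1. Qed.

(** These are the entries of A A^T, which for A in the Stiefel manifold is the orthogonal projection
    onto the column space. Its trace k and its idempotence are what the moment computation uses
    besides invariance. *)
Definition row_gram (R : realType) (n k : nat) (i j : 'I_n) (A : 'M[R]_(n, k)) : R :=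
  \sum_(l < k) A i l * A j l.

Lemma row_gramE (R : realType) (n k : nat) (i j : 'I_n) (A : 'M[R]_(n, k)) :
  row_gram i j A = (A *m A^T) i j.
Proof. by rewrite mxE; apply: eq_bigr => l _; rewrite mxE. Qed.

Lemma stiefel_fun_row_gram (R : realType) (n k : nat) (i j : 'I_n) :
  stiefel_fun (row_gram (R := R) (k := k) i j).
Proof. by apply: stiefel_fun_sum => l; apply: stiefel_funM; exact: stiefel_fun_coord. Qed.

Lemma row_gram_trace (R : realType) (n k : nat) (A : 'M[R]_(n, k)) :
  stiefel A -> \sum_i row_gram i i A = k%:R.
Proof.
move=> sA; rewrite exchange_big /= -[RHS](@mxtrace1 R k) -sA.
by apply: eq_bigr => l _; rewrite mxE; apply: eq_bigr => i _; rewrite mxE.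
Qed.

Lemma row_gram_sqr (R : realType) (n k : nat) (i : 'I_n) (A : 'M[R]_(n, k)) :
  stiefel A -> \sum_j row_gram i j A ^+ 2 = row_gram i i A.
Proof.
move=> sA; rewrite [RHS]row_gramE -[X in X *m A^T](mulmx1 A) -sA.
rewrite mulmxA -mulmxA mxE; apply: eq_bigr => j _.
rewrite -!row_gramE expr2; congr (_ * _).
by apply: eq_bigr => l _; rewrite mulrC.
Qed.

Lemma sqnorm_tr_delta (R : realType) (n k : nat) (i : 'I_n) (A : 'M[R]_(n, k)) :
  sqnorm (A^T *m delta_mx i 0) = row_gram i i A.
Proof. by apply: eq_bigr => l _; rewrite -colE !mxE expr2. Qed.

Section row_moments.
Context {R : realType} {n k : nat}.
Variable mu : probability (borelType 'M[R]_(n, k)) R.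
Hypothesis haar_mu : stiefel_haar mu.
Variable i0 : 'I_n.

Let moment m := stiefel_mean mu (fun A => row_gram i0 i0 A ^+ m).

Let mean_sqnormX (u : 'cV[R]_n) m : sqnorm u = 1 ->
  stiefel_mean mu (fun A => sqnorm (A^T *m u) ^+ m) = moment m.
Proof.
move=> /sqnorm1_trmx /(orthogonal_to_unit i0) [W oW Wu]; rewrite -Wu.
rewrite /moment -[RHS](@stiefel_mean_rot _ _ _ _ haar_mu W^T); last 2 first.
- by rewrite trmxK; exact: mulmx1C.
- exact/stiefel_funX/stiefel_fun_row_gram.
apply: stiefel_mean_eq => A _.
by rewrite -sqnorm_tr_delta trmx_mul trmxK mulmxA.
Qed.

Let axis_moment (i : 'I_n) m : i != i0 ->
  stiefel_mean mu (fun A => row_gram i0 i0 A ^+ m * row_gram i i A) +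
  2 * m%:R * stiefel_mean mu (fun A => row_gram i0 i0 A ^+ m.-1 * row_gram i0 i A ^+ 2)
  = moment m.+1.
Proof.
move=> ii0.
pose Q (A : 'M[R]_(n, k)) : {poly R} := (row_gram i0 i0 A)%:P +
  (2 * row_gram i0 i A) *: 'X + row_gram i i A *: 'X^2.
have Q_fun j : stiefel_fun (fun A => (Q A)`_j).
  under eq_fun do rewrite !coefE.
  apply: stiefel_funD; first apply: stiefel_funD.
  - case: j => [|j] /=; [exact: stiefel_fun_row_gram|exact: stiefel_fun_cst].
  - apply: stiefel_funM; last exact: stiefel_fun_cst.
    by apply: stiefel_funZ; exact: stiefel_fun_row_gram.
  - apply: stiefel_funM; last exact: stiefel_fun_cst.
    exact: stiefel_fun_row_gram.
have QX_fun p j : stiefel_fun (fun A => (Q A ^+ p)`_j).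
  elim: p j => [|p IH] j; first exact: (stiefel_fun_cst (1 : {poly R})`_j).
  under eq_fun do rewrite exprS coefM.
  by apply: stiefel_fun_sum => l; exact: stiefel_funM.
pose N := (2 * m.+1).+1.
have polyE : \poly_(j < N) stiefel_mean mu (fun A => (Q A ^+ m.+1)`_j) =
    moment m.+1 *: (1 + 'X^2) ^+ m.+1.
  apply: poly_funext_eq => t; rewrite horner_poly !hornerE.
  transitivity (stiefel_mean mu (fun A => (Q A ^+ m.+1).[t])).
    under eq_bigr => j _ do rewrite mulrC -(stiefel_meanZ mu _ (QX_fun _ _)).
    rewrite -(stiefel_mean_sum haar_mu); last by move=> j; exact: stiefel_funZ.
    apply: stiefel_mean_eq => A _.
    rewrite (@horner_coef_wide _ N); last exact: size_quadX.
    by apply: eq_bigr => j _; rewrite mulrC.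
  have t1 : 0 < 1 + t ^+ 2 by rewrite ltr_pwDl ?sqr_ge0.
  pose w : 'cV[R]_n := delta_mx i0 0 + t *: delta_mx i 0.
  have sqw A : sqnorm (A^T *m w) = (Q A).[t].
    transitivity (\sum_l (A i0 l * A i0 l + (2 * t) * (A i0 l * A i l) +
        t ^+ 2 * (A i l * A i l))).
      by apply: eq_bigr => l _; rewrite mulmxDr -scalemxAr -!colE !mxE; ring.
    rewrite !big_split /= -!mulr_sumr -!/(row_gram _ _ _).
    by rewrite /Q !hornerD hornerC !hornerZ hornerX hornerXn; ring.
  have w1 : sqnorm w = 1 + t ^+ 2.
    rewrite sqnormE /w mulmxDr linearD /= linearZ /= !mulmxDl -!scalemxAl -!scalemxAr.
    rewrite !trmx_delta !mul_delta_mx_cond eqxx (negPf ii0) eq_sym (negPf ii0).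
    rewrite eqxx !mulr1n !mulr0n !scaler0 add0r addr0 !mxE !eqxx /=.
    by rewrite !mulr1n !mulr1 expr2.
  rewrite -(mean_sqnormX (u := (Num.sqrt (1 + t ^+ 2))^-1 *: w)); last first.
    by rewrite sqnormZ w1 exprVn sqr_sqrtr ?(ltW t1)// mulVf ?gt_eqF.
  rewrite mulrC -stiefel_meanZ; last first.
    apply/stiefel_funX/stiefel_fun_sum => l; apply: stiefel_funX.
    under eq_fun do rewrite mxE; apply: stiefel_fun_sum => j.
    by under eq_fun do rewrite mxE mulrC; apply: stiefel_funZ; exact: stiefel_fun_coord.
  apply: stiefel_mean_eq => A _.
  rewrite -scalemxAr sqnormZ exprVn sqr_sqrtr ?(ltW t1)// sqw.
  by rewrite exprMn mulrA -exprMn mulfV ?gt_eqF// expr1n mul1r horner_exp.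
have := congr1 (fun p : {poly R} => p`_2) polyE.
rewrite coef_poly /= coefZ coef2_1DX2 ifT; last by rewrite /N; lia.
under stiefel_mean_eq => A _ do rewrite /Q coef2_quadX.
have fa p i' : stiefel_fun (fun A : 'M[R]_(n, k) => row_gram i0 i0 A ^+ p * row_gram i' i' A).
  by apply: stiefel_funM; [apply: stiefel_funX|]; exact: stiefel_fun_row_gram.
have fb p : stiefel_fun (fun A : 'M[R]_(n, k) => row_gram i0 i0 A ^+ p * row_gram i0 i A ^+ 2).
  by apply: stiefel_funM; apply: stiefel_funX; exact: stiefel_fun_row_gram.
rewrite stiefel_meanD; [|exact: stiefel_funZ|by do 2 apply: stiefel_funZ].
rewrite !stiefel_meanZ//; last exact: stiefel_funZ.
by rewrite -mulrDr [RHS]mulrC => /mulfI -> //; rewrite pnatr_eq0.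
Qed.

(** Write G = A A^T and M_m for the moment. Summing [axis_moment] over i != i0, with trace G = k and
    sum_i G_(i0,i)^2 = V, gives (n - 1) M_(m+1) = k M_m - M_(m+1) + 2 m (M_m - M_(m+1)), that is (n
    + 2 m) M_(m+1) = (k + 2 m) M_m. *)
Lemma row_momentE m : moment m = stiefel_moment R k n m.
Proof.
elim: m => [|m IH].
  by rewrite /moment /stiefel_moment big_ord0 -[RHS](stiefel_mean_cst haar_mu).
have n0 : (n + 2 * m)%:R != 0 :> R.
  by rewrite pnatr_eq0 addn_eq0 negb_and -lt0n (leq_trans _ (ltn_ord i0)).
rewrite stiefel_momentS -IH.
apply: (mulIf n0); rewrite -mulrA mulfVK//.
have fG i j : stiefel_fun (row_gram (R := R) (k := k) i j) by exact: stiefel_fun_row_gram.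
have fX p : stiefel_fun (fun A : 'M[R]_(n, k) => row_gram i0 i0 A ^+ p).
  exact: stiefel_funX.
have sum1 : \sum_(i | i != i0) moment m.+1 = (n%:R - 1) * moment m.+1.
  rewrite sumr_const -[LHS]mulr_natl; congr (_ * _).
  by rewrite cardC1 card_ord -subn1 natrB// (leq_trans _ (ltn_ord i0)).
have sumd : \sum_(i | i != i0) stiefel_mean mu
    (fun A => row_gram i0 i0 A ^+ m * row_gram i i A) =
    k%:R * moment m - moment m.+1.
  rewrite -(stiefel_mean_sum haar_mu); last by move=> i; exact: stiefel_funM.
  rewrite -stiefel_meanZ// -[X in _ - X]mul1r -mulNr -stiefel_meanZ//.
  rewrite -stiefel_meanD; [|exact: stiefel_funZ|exact: stiefel_funZ].
  apply: stiefel_mean_eq => A sA; rewrite -(row_gram_trace sA) -mulr_sumr.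
  by rewrite [in RHS](bigD1 i0)//= exprS; ring.
have sumb : \sum_(i | i != i0) (2 * m%:R * stiefel_mean mu
    (fun A => row_gram i0 i0 A ^+ m.-1 * row_gram i0 i A ^+ 2)) =
    2 * m%:R * (moment m - moment m.+1).
  case: m {IH n0 sum1 sumd} => [|m]; first by rewrite mulr0 mul0r big1// => i _; rewrite mul0r.
  rewrite -mulr_sumr -(stiefel_mean_sum haar_mu); last first.
    by move=> i; apply: stiefel_funM => //; exact: stiefel_funX.
  congr (_ * _); rewrite -[X in _ - X]mul1r -mulNr -stiefel_meanZ//.
  rewrite -stiefel_meanD//; last exact: stiefel_funZ.
  apply: stiefel_mean_eq => A sA; rewrite -mulr_sumr /=.
  have := row_gram_sqr i0 sA; rewrite (bigD1 i0)//= => /esym/eqP.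
  rewrite [_ + _ in X in _ == X]addrC -subr_eq => /eqP <-; rewrite !exprS; ring.
have : \sum_(i | i != i0) (stiefel_mean mu
      (fun A => row_gram i0 i0 A ^+ m * row_gram i i A) +
    2 * m%:R * stiefel_mean mu
      (fun A => row_gram i0 i0 A ^+ m.-1 * row_gram i0 i A ^+ 2)) =
    \sum_(i | i != i0) moment m.+1.
  by apply: eq_bigr => i ii0; exact: axis_moment.
rewrite big_split /= sumd sumb sum1 (natrD _ n) (natrD _ k) (natrM _ 2 m).
by move=> H; nra.
Qed.

End row_moments.

(** * Tails of a squared row norm *)

Section row_tail.
Context {R : realType} {n k : nat}.
Variable mu : probability (borelType 'M[R]_(n, k)) R.
Hypothesis haar_mu : stiefel_haar mu.
Variable i0 : 'I_n.

Lemma row_gram_ge_borel (c : R) :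
  borel [set A : 'M[R]_(n, k) | c <= row_gram i0 i0 A].
Proof.
have [mG _] := @stiefel_fun_row_gram R n k i0 i0.
have -> : [set A : 'M[R]_(n, k) | c <= row_gram i0 i0 A] =
    row_gram i0 i0 @^-1` `[c, +oo[%classic.
  by apply/seteqP; split => A /=; rewrite in_itv /= andbT.
by rewrite -[X in borel X]setTI; exact: mG.
Qed.

Lemma row_gram_ge0 (A : 'M[R]_(n, k)) : 0 <= row_gram i0 i0 A.
Proof. by apply: sumr_ge0 => l _; rewrite -expr2 sqr_ge0. Qed.

(* Markov's inequality applied to the increasing function
   [V |-> (1 - l V) ^- v.+1] of the squared row norm [V], expanded in a
   binomial series so that only integer moments occur. *)
Lemma row_tail_le (v k' : nat) (l c : R) :
  k = k'.+1 -> (2 * v.+1 <= n)%N -> 0 < l < 1 -> 0 <= c -> l * c < 1 ->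
  fine (mu [set A | c <= row_gram i0 i0 A]) <=
  ((1 - l) ^+ k'.+1)^-1 * (1 - l * c) ^+ v.+1.
Proof.
move=> kE vn /andP[l0 l1] c0 lc1.
set B := [set A | _]; set p := fine _.
have bB : borel B by exact: row_gram_ge_borel.
have lc0 : 0 <= l * c by rewrite mulr_ge0// ltW.
have fV m : stiefel_fun (fun A : 'M[R]_(n, k) => row_gram i0 i0 A ^+ m).
  exact/stiefel_funX/stiefel_fun_row_gram.
have K0 : 0 < (1 - l) ^+ k'.+1 by rewrite exprn_gt0// subr_gt0.
(* The event is compared with the truncated series at l V, whose mean is at most the truncated
   series of (1 - l)^-(k'+1). The truncation is removed at the end by letting N grow. *)
have bound N : p * negbin v (l * c) N <= ((1 - l) ^+ k'.+1)^-1.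
  apply: (@le_trans _ _ (negbin k' l N)); last first.
    by rewrite -[leRHS]mul1r ler_pdivlMr// mulrC negbin_le// !ltW.
  apply: (@le_trans _ _ (stiefel_mean mu
      (fun A => \sum_(m < N) ('C(v + m, m)%:R * l ^+ m) * row_gram i0 i0 A ^+ m))).
    rewrite /p -(stiefel_mean_indic haar_mu)// mulrC -stiefel_meanZ; last first.
      exact: stiefel_fun_indic.
    apply: le_stiefel_mean.
    - by apply: stiefel_funZ; exact: stiefel_fun_indic.
    - by apply: stiefel_fun_sum => m; exact: stiefel_funZ.
    - move=> A _; rewrite indicE; have [/set_mem AB|_] := boolP (A \in B); last first.
        rewrite mulr0; apply: sumr_ge0 => m _.
        by rewrite !mulr_ge0 ?exprn_ge0 ?row_gram_ge0 ?(ltW l0).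
      rewrite mulr1; apply: ler_sum => m _; rewrite -mulrA ler_wpM2l//.
      by rewrite -exprMn lerXn2r ?nnegrE ?mulr_ge0 ?row_gram_ge0 ?(ltW l0)// ler_wpM2l ?(ltW l0).
  rewrite (stiefel_mean_sum haar_mu); last by move=> m; exact: stiefel_funZ.
  apply: ler_sum => m _; rewrite stiefel_meanZ//.
  rewrite (row_momentE haar_mu) mulrAC ler_wpM2r ?exprn_ge0 ?(ltW l0)//.
  by rewrite kE; exact: bin_stiefel_moment_le.
have lcv : 0 < 1 - l * c by rewrite subr_gt0.
have cvg_p : (p * ((1 - l * c) ^+ v.+1 * negbin v (l * c) N)) @[N --> \oo] --> (p * 1 : R).
  by apply: cvgM; [exact: cvg_cst|apply: negbin_cvg; rewrite lc0].
rewrite -[leLHS]mulr1; apply: (cvgr_to_le cvg_p).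
by apply: nearW => N; rewrite mulrCA [leRHS]mulrC ler_pM2l ?exprn_gt0.
Qed.

End row_tail.

(* Under the tilted measure [V ^+ m d mu], the variable [V] has mean
   [(2 m + 1) / (n + 2 m)] and relative variance at most [2 / (2 m + 1)], so
   that it concentrates around its mean. *)
Lemma row_tail_ge (R : realType) (n : nat)
    (mu : probability (borelType 'M[R]_(n, 1)) R) (haar_mu : stiefel_haar mu)
    (i0 : 'I_n) (v m : nat) (dlt : R) :
  let mean : R := (2 * m.+1 + 1)%:R / (n + 2 * m.+1)%:R in
  (n <= 2 * v.+1)%N -> 0 < dlt -> 4 <= (2 * m.+1 + 1)%:R * dlt ^+ 2 ->
  (1 - mean) ^+ v.+1 / (4 * m.+1%:R * (1 + dlt) ^+ m.+1) <=
  fine (mu [set A | (1 - dlt) * mean <= row_gram i0 i0 A]).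
Proof.
move=> mean nv dlt0 mdlt; set B := [set A | _]; set p := fine _.
have n0 : (0 < n)%N by exact: leq_ltn_trans (ltn_ord i0).
have nm0 : 0 < (n + 2 * m.+1)%:R :> R by rewrite ltr0n; lia.
have mean0 : 0 < mean by rewrite divr_gt0// ltr0n; lia.
have mean1 : mean <= 1 by rewrite ler_pdivrMr// mul1r ler_nat; lia.
have bB : borel B by exact: row_gram_ge_borel.
have dm0 : 0 < dlt * mean by rewrite mulr_gt0.
pose V (A : 'M[R]_(n, 1)) := row_gram i0 i0 A.
have fV j : stiefel_fun (fun A => V A ^+ j) by exact/stiefel_funX/stiefel_fun_row_gram.
pose M j := stiefel_moment R 1 n j.
have ME j : stiefel_mean mu (fun A => V A ^+ j) = M j by exact: row_momentE.
have M0 : 0 < M m.+1 by exact: stiefel_moment_gt0.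
pose C := ((1 + dlt) * mean) ^+ m.+1.
have C0 : 0 < C by rewrite exprn_gt0// mulr_gt0// ltr_pwDl// ltW.
pose a := (dlt * mean) ^- 2.
have a0 : 0 < a by rewrite invr_gt0 exprn_gt0.
(* Chebyshev's inequality under the tilted measure, written pointwise: far from [mean] the quadratic
   term is at least V^(m+1); near it, V^(m+1) is at most [C] and the point lies in [B]. *)
have main : M m.+1 <= a * M m.+3 + (- (2 * mean * a) * M m.+2 +
    (mean ^+ 2 * a * M m.+1 + C * p)).
  rewrite -!ME /p -(stiefel_mean_indic haar_mu)// -!stiefel_meanZ//; last first.
    exact: stiefel_fun_indic.
  have fI : stiefel_fun (fun A => C * \1_B A).
    by apply: stiefel_funZ; exact: stiefel_fun_indic.
  have f1 := stiefel_funD (stiefel_funZ (mean ^+ 2 * a) (fV m.+1)) fI.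
  have f2 := stiefel_funD (stiefel_funZ (- (2 * mean * a)) (fV m.+2)) f1.
  have f3 := stiefel_funD (stiefel_funZ a (fV m.+3)) f2.
  rewrite -stiefel_meanD//; last by exact: stiefel_funZ.
  rewrite -stiefel_meanD//; last by exact: stiefel_funZ.
  rewrite -stiefel_meanD//; last by exact: stiefel_funZ.
  apply: le_stiefel_mean => // A _.
  have V0 : 0 <= V A by exact: row_gram_ge0.
  rewrite [leRHS](_ : _ = V A ^+ m.+1 * (a * (V A - mean) ^+ 2) + C * \1_B A); last first.
    by rewrite !exprS; ring.
  have sq0 : 0 <= V A ^+ m.+1 * (a * (V A - mean) ^+ 2).
    by rewrite mulr_ge0 ?exprn_ge0// mulr_ge0 ?sqr_ge0// ltW.
  have [far|near] := leP (dlt * mean) `|V A - mean|.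
    rewrite -[leLHS]addr0 lerD//; last by rewrite mulr_ge0 ?(ltW C0)// indicE.
    rewrite -[leLHS]mulr1 ler_wpM2l ?exprn_ge0// /a mulrC ler_pdivlMr ?exprn_gt0//.
    by rewrite mul1r -(real_normK (num_real (V A - mean))) lerXn2r ?nnegrE// ltW.
  move: near; rewrite ltr_norml => /andP[near1 near2].
  have AB : A \in B by apply/mem_set; rewrite /B /= -/(V A) mulrBl mul1r; lra.
  rewrite indicE AB mulr1 -[leLHS]add0r lerD// /C lerXn2r ?nnegrE//.
    by rewrite mulr_ge0 ?(ltW mean0)//; lra.
  by rewrite mulrDl mul1r; lra.
have M1 : M m.+2 = M m.+1 * mean.
  by rewrite /M stiefel_momentS /mean addnC.
pose mean' : R := (2 * m.+2 + 1)%:R / (n + 2 * m.+2)%:R.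
have M2 : M m.+3 = M m.+1 * mean * mean'.
  by rewrite -M1 /M stiefel_momentS /mean' addnC.
(* The tilted variance of V is mean (mean' - mean). The hypothesis on dlt makes it at most half of
   (dlt mean)^2, so that at least half of the tilted mass is near the mean. *)
have var : mean' - mean <= mean * dlt ^+ 2 / 2.
  have -> : mean' - mean = 2 * (n%:R - 1) / ((n + 2 * m.+1)%:R * (n + 2 * m.+2)%:R).
    rewrite /mean' /mean; move: nm0; rewrite !(natrD, natrM, mulrS) => nm0.
    field; apply/andP; split; apply/eqP; nra.
  rewrite ler_pdivrMr; last by rewrite mulr_gt0// ltr0n; lia.
  rewrite /mean; set N := (n + _)%:R; set N' := (n + _)%:R.
  rewrite [leRHS](_ : _ = ((2 * m.+1 + 1)%:R * dlt ^+ 2) / 2 * N'); last first.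
    by field; rewrite gt_eqF.
  have N'E : N' = n%:R + 2 * m%:R + 4 by rewrite /N' !(natrD, natrM, mulrS); ring.
  have n1 : 1 <= n%:R :> R by rewrite ler1n.
  have m0 : 0 <= m%:R :> R by [].
  rewrite (@le_trans _ _ (4 / 2 * N'))//; first by rewrite N'E; lra.
  by rewrite ler_wpM2r ?ler_wpM2r//; rewrite N'E; lra.
have half : M m.+1 <= 2 * (C * p).
  have varM : a * (M m.+1 * mean * mean') - 2 * mean * a * (M m.+1 * mean)
      + mean ^+ 2 * a * M m.+1 <= M m.+1 / 2.
    have -> : a * (M m.+1 * mean * mean') - 2 * mean * a * (M m.+1 * mean)
        + mean ^+ 2 * a * M m.+1 = M m.+1 * (mean * (mean' - mean) * a) by ring.
    rewrite ler_wpM2l ?(ltW M0)// /a ler_pdivrMr ?exprn_gt0//.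
    rewrite exprMn [leRHS](_ : _ = mean * (mean * dlt ^+ 2 / 2)); last by ring.
    by rewrite ler_wpM2l ?(ltW mean0).
  by move: main; rewrite M2 M1; lra.
(* With x = mean, the power mean^(m+1) cancels against the one in [C], leaving (1 - mean)^(v+1), a
   factor linear in m and (1 + dlt)^(m+1). *)
have lower : mean ^+ m.+1 * (1 - mean) ^+ v.+1 / (2 * m.+1%:R) <= M m.+1.
  by apply: stiefel_moment1_ge => //; rewrite mean1 ltW.
rewrite ler_pdivrMr; last by rewrite mulr_gt0 ?exprn_gt0 ?mulr_gt0 ?ltr0n//; lra.
have CE : C = (1 + dlt) ^+ m.+1 * mean ^+ m.+1 by rewrite -exprMn.
have := le_trans lower half; rewrite CE ler_pdivrMr ?mulr_gt0 ?ltr0n//.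
rewrite [leRHS](_ : _ = mean ^+ m.+1 * (p * (4 * m.+1%:R * (1 + dlt) ^+ m.+1))); last by ring.
by rewrite ler_pM2l ?exprn_gt0.
Qed.

(** * Exponential decay and growth *)

(** Stands for limsup (1/s) log p <= - L, and [growth] below for liminf (1/s) log p >= - L. The
    exponential form avoids log 0, and the strict slack in L' absorbs every subexponential
    factor. *)
Definition decay (R : realType) (s p : nat -> R) (L : R) : Prop :=
  forall L', L' < L -> \forall n \near \oo, p n <= expR (- (s n * L')).

Definition growth (R : realType) (s p : nat -> R) (L : R) : Prop :=
  forall L', L < L' -> \forall n \near \oo, expR (- (s n * L')) <= p n.

Section decay.
Context {R : realType} {s : nat -> R}.
Hypothesis s_oo : s n @[n --> \oo] --> +oo.
Implicit Types (p q : nat -> R) (L : R).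

Lemma near_s_ge (c : R) : \forall n \near \oo, c <= s n.
Proof. by move/cvgryPge : s_oo; exact. Qed.

Lemma decay_le p q L L' : (\forall n \near \oo, q n <= p n) -> L' <= L ->
  decay s p L -> decay s q L'.
Proof.
move=> qp LL' dp L2 L2L'; apply: filterS2 qp (dp _ (lt_le_trans L2L' LL')) => n.
exact: le_trans.
Qed.

Lemma growth_le p q L L' : (\forall n \near \oo, p n <= q n) -> L <= L' ->
  growth s p L -> growth s q L'.
Proof.
move=> pq LL' gp L2 L2L'; apply: filterS2 pq (gp _ (le_lt_trans LL' L2L')) => n.
by move=> pq_n /le_trans; exact.
Qed.

(** The factor 2 is absorbed between L' and the midpoint M, since exp (s (M - L')) >= 2 for large
    n. *)
Lemma decayD p q L : decay s p L -> decay s q L -> decay s (fun n => p n + q n) L.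
Proof.
move=> dp dq L' L'L; pose M := (L' + L) / 2.
have [L'M ML] : L' < M /\ M < L by rewrite /M; split; lra.
have pM := dp _ ML; have qM := dq _ ML; have sM := near_s_ge (2 / (M - L')).
near=> n.
apply: (@le_trans _ _ (2 * expR (- (s n * M)))).
  by rewrite mulr2n mulrDl mul1r lerD//; near: n.
have -> : - (s n * L') = s n * (M - L') + (- (s n * M)) by ring.
rewrite expRD ler_wpM2r ?expR_ge0//; apply: le_trans (expR_ge1Dx _).
have : 2 / (M - L') <= s n by near: n.
by rewrite ler_pdivrMr ?subr_gt0//; lra.
Unshelve. all: by end_near. Qed.

Lemma decayM p q L M : (forall n, 0 <= p n) -> (forall n, 0 <= q n) ->
  decay s p L -> decay s q M -> decay s (fun n => p n * q n) (L + M).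
Proof.
move=> p0 q0 dp dq L' L'L; pose e := (L + M - L') / 2.
have e0 : 0 < e by rewrite /e; lra.
have pL := dp (L - e) ltac:(lra); have qM := dq (M - e) ltac:(lra).
near=> n; have -> : - (s n * L') = - (s n * (L - e)) + - (s n * (M - e)).
  by rewrite /e; field.
by rewrite expRD ler_pM//; near: n.
Unshelve. all: by end_near. Qed.

Lemma growthM p q L M :
  growth s p L -> growth s q M -> growth s (fun n => p n * q n) (L + M).
Proof.
move=> dp dq L' L'L; pose e := (L' - (L + M)) / 2.
have e0 : 0 < e by rewrite /e; lra.
have pL := dp (L + e) ltac:(lra); have qM := dq (M + e) ltac:(lra).
near=> n; have -> : - (s n * L') = - (s n * (L + e)) + - (s n * (M + e)).
  by rewrite /e; field.
by rewrite expRD ler_pM ?expR_ge0//; near: n.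
Unshelve. all: by end_near. Qed.

Lemma decay_le1 p L : (\forall n \near \oo, p n <= 1) -> L <= 0 -> decay s p L.
Proof.
move=> p1 L0 L' L'L; have s0 := near_s_ge 0.
near=> n; have /le_trans : p n <= 1 by near: n.
apply; rewrite -expR0 ler_expR oppr_ge0.
by rewrite mulr_ge0_le0//; [near: n|lra].
Unshelve. all: by end_near. Qed.

Lemma growth_cst (c : R) : 0 < c -> growth s (fun=> c) 0.
Proof.
move=> c0 L L0; have s0 := near_s_ge (c^-1 / L).
near=> n; rewrite expRN invf_ple ?posrE ?expR_gt0//.
apply: (@le_trans _ _ (s n * L)); last first.
  by apply: le_trans (expR_ge1Dx _); rewrite lerDr.
by rewrite -ler_pdivrMr//; near: n.
Unshelve. all: by end_near. Qed.

(** A term of strictly faster decay cannot destroy a lower bound: two rates L < L1 < L2 below both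
    L' and M are inserted, and exp (- s L1) dominates 2 exp (- s L2). *)
Lemma decay_growth_sub p q L M : L < M -> growth s p L -> decay s q M ->
  growth s (fun n => p n - q n) L.
Proof.
move=> LM gp dq L' LL'.
pose L1 := L + Num.min (L' - L) (M - L) / 3; pose L2 := L + 2 * (Num.min (L' - L) (M - L) / 3).
have m0 : 0 < Num.min (L' - L) (M - L) by rewrite lt_min !subr_gt0 LL'.
have mL : Num.min (L' - L) (M - L) <= L' - L by rewrite ge_min lexx.
have mM : Num.min (L' - L) (M - L) <= M - L by rewrite ge_min lexx orbT.
have [LL1 L12 L2L' L2M] : [/\ L < L1, L1 < L2, L2 < L' & L2 < M].
  by rewrite /L1 /L2; split; lra.
have pL := gp _ LL1; have qM := dq _ L2M; have sM := near_s_ge (1 / (L2 - L1)).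
have s0 := near_s_ge 0.
near=> n.
have pn : expR (- (s n * L1)) <= p n by near: n.
have qn : q n <= expR (- (s n * L2)) by near: n.
have sn0 : 0 <= s n by near: n.
have sn : 1 <= s n * (L2 - L1).
  by rewrite -ler_pdivrMr ?subr_gt0//; near: n.
apply: le_trans (lerB pn qn).
apply: (@le_trans _ _ (expR (- (s n * L2)))).
  by rewrite ler_expR lerN2 ler_wpM2l// ltW.
rewrite lerBrDr -mulr2n -mulr_natl.
have -> : - (s n * L1) = s n * (L2 - L1) + (- (s n * L2)) by ring.
rewrite expRD ler_wpM2r ?expR_ge0//; apply: le_trans (expR_ge1Dx _).
by lra.
Unshelve. all: by end_near. Qed.

End decay.

Section log_scale.
Context {R : realType}.
Implicit Types (s p L : R).
Local Open Scope ereal_scope.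

(** At p = 0 both sides are true, as [lne] is -oo there; in the companion lower bound both are
    false. *)
Lemma lne_le_rate s p L : (0 < s)%R -> (0 <= p)%R ->
  (s^-1%:E * lne p%:E <= (- L)%:E) = (p <= expR (- (s * L)))%R.
Proof.
move=> s0; rewrite le_eqVlt => /predU1P[<-|p0].
  rewrite le0_lneNy// gt0_muleNy ?lte_fin ?invr_gt0// leNye expR_ge0//.
rewrite lne_EFin// -EFinM lee_fin ler_pdivrMl// -[in RHS](lnK p0).
by rewrite ler_expR mulrN.
Qed.

Lemma lne_ge_rate s p L : (0 < s)%R -> (0 <= p)%R ->
  ((- L)%:E <= s^-1%:E * lne p%:E) = (expR (- (s * L)) <= p)%R.
Proof.
move=> s0; rewrite le_eqVlt => /predU1P[<-|p0].
  rewrite le0_lneNy// gt0_muleNy ?lte_fin ?invr_gt0// leeNy_eq/=.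
  by apply/esym/negbTE; rewrite -ltNge expR_gt0.
rewrite lne_EFin// -EFinM lee_fin ler_pdivlMl// -[in RHS](lnK p0).
by rewrite ler_expR mulrN.
Qed.

Lemma ereal_between (a b : \bar R) : a < b -> exists r : R, a < r%:E < b.
Proof.
case: a => [a| |]; case: b => [b| |] //=.
- rewrite lte_fin => ab; exists ((a + b) / 2)%R; rewrite !lte_fin.
  by apply/andP; split; lra.
- by move=> _; exists (a + 1)%R; rewrite lte_fin ltrDl ltr01 ltry.
- by move=> _; exists (b - 1)%R; rewrite lte_fin ltNyr /= gtrBl ltr01.
- by move=> _; exists 0%R; rewrite ltNyr ltry.
Qed.

Lemma limn_esup_le (u : (\bar R)^nat) (b : \bar R) :
  (forall a : R, b < a%:E -> \forall n \near \oo, u n <= a%:E) ->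
  limn_esup u <= b.
Proof.
move=> ub; rewrite leNgt; apply/negP => /ereal_between[a /andP[ba]].
apply/negP; rewrite -leNgt /limn_esup limf_esupE.
apply: (@le_trans _ _ (ereal_sup (u @` [set n | u n <= a%:E]))).
  by apply: ereal_inf_lbound; exists [set n | u n <= a%:E] => //; exact: ub.
by apply: ge_ereal_sup => _ [n + <-].
Qed.

Lemma limn_einf_ge (u : (\bar R)^nat) (b : \bar R) :
  (forall a : R, a%:E < b -> \forall n \near \oo, a%:E <= u n) ->
  b <= limn_einf u.
Proof.
move=> ub; rewrite /limn_einf leeNr; apply: limn_esup_le => a ba.
have := ub (- a)%R; rewrite EFinN lteNl => /(_ ba); apply: filterS => n.
by rewrite leeNl.
Qed.

Lemma limn_esup_lt (u : (\bar R)^nat) (a : \bar R) :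
  limn_esup u < a -> \forall n \near \oo, u n < a.
Proof.
rewrite /limn_esup limf_esupE => /ereal_inf_lt[_ [A FA <-] Aa].
apply: filterS FA => n An; apply: le_lt_trans Aa.
by apply: ereal_sup_ubound; exists n.
Qed.

Lemma limn_einf_gt (u : (\bar R)^nat) (a : \bar R) :
  a < limn_einf u -> \forall n \near \oo, a < u n.
Proof.
rewrite /limn_einf lteNr => /limn_esup_lt; apply: filterS => n.
by rewrite lteNr oppeK.
Qed.

End log_scale.

Lemma fine_prob_fin d (T : measurableType d) (R : realType) (P : probability T R)
    (E : set T) : measurable E -> P E = (fine (P E))%:E.
Proof. by move=> mE; rewrite fineK// fin_num_measure. Qed.

Lemma fine_prob_ge0 d (T : measurableType d) (R : realType) (P : probability T R)
    (E : set T) : 0 <= fine (P E).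
Proof. by rewrite fine_ge0// measure_ge0. Qed.

Lemma fine_prob_le1 d (T : measurableType d) (R : realType) (P : probability T R)
    (E : set T) : measurable E -> fine (P E) <= 1.
Proof. by move=> mE; rewrite -lee_fin -fine_prob_fin// probability_le1. Qed.

Lemma le_fine_prob d (T : measurableType d) (R : realType) (P : probability T R)
    (E F : set T) : measurable E -> measurable F -> E `<=` F ->
  fine (P E) <= fine (P F).
Proof.
by move=> mE mF EF; rewrite -lee_fin -!fine_prob_fin// le_measure ?inE.
Qed.

Lemma fine_probU_le d (T : measurableType d) (R : realType) (P : probability T R)
    (E F : set T) : measurable E -> measurable F ->
  fine (P (E `|` F)) <= fine (P E) + fine (P F).
Proof.
move=> mE mF; rewrite -lee_fin EFinD -!fine_prob_fin//; last exact: measurableU.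
exact: measureU2.
Qed.

Lemma fine_probD_ge d (T : measurableType d) (R : realType) (P : probability T R)
    (E F : set T) : measurable E -> measurable F ->
  fine (P E) - fine (P F) <= fine (P (E `\` F)).
Proof.
move=> mE mF; rewrite lerBlDr; apply: le_trans (fine_probU_le _ _ _) => //.
  apply: le_fine_prob => //; first by apply: measurableU => //; exact: measurableD.
  by move=> t Et; have [Ft|Ft] := pselect (F t); [right|left].
exact: measurableD.
Qed.

Lemma random_element_preimage d (T : measurableType d) (S : ptopologicalType)
    (f : T -> S) (B : set S) :
  random_element f -> borel B -> measurable (f @^-1` B).
Proof. by move=> mf bB; rewrite -[X in measurable X]setTI; exact: mf. Qed.

(** * Large deviation bounds restated as decay and growth *)

Section LDP_log_scale.
Context {R : realType} {d : nat -> measure_display}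
  {T : forall n, measurableType (d n)} {P : forall n, probability (T n) R}
  {S : ptopologicalType} {eta : forall n, T n -> S} {s : nat -> R} {N0 : nat}
  {I : S -> \bar R}.
Hypothesis s_gt0 : forall n, (N0 <= n)%N -> 0 < s n.
Hypothesis meta : forall n, (N0 <= n)%N -> random_element (@eta n).

Let near_N0 : \forall n \near \oo, (N0 <= n)%N.
Proof. by exists N0. Qed.

Lemma LDP_decay (F : set S) (L : R) : LDP P (@eta) s I ->
  closed F -> (forall x, F x -> (L%:E <= I x)%E) ->
  decay s (fun n => fine (P n (@eta n @^-1` F))) L.
Proof.
move=> [_ _ ldp] cF FL L' L'L.
have [_ _] := ldp _ (borel_closed cF).
have -> : closure F = F by apply/esym/closure_id.
move=> /le_lt_trans => /(_ (- L')%:E) ub.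
have : (- ereal_inf (I @` F) < (- L')%:E)%E.
  rewrite EFinN lteN2; apply: (@lt_le_trans _ _ L%:E); first by rewrite lte_fin.
  by apply: le_ereal_inf_tmp => _ [x Fx <-]; exact: FL.
move=> /ub /limn_esup_lt h; near=> n.
have n0 : (N0 <= n)%N by near: n.
have mE := random_element_preimage (meta n0) (borel_closed cF).
rewrite -lne_le_rate ?s_gt0 ?fine_prob_ge0// -fine_prob_fin//.
by apply/ltW; near: n.
Unshelve. all: by end_near. Qed.

Lemma LDP_growth (G : set S) (x : S) (L : R) : LDP P (@eta) s I ->
  open G -> G x -> (I x <= L%:E)%E ->
  growth s (fun n => fine (P n (@eta n @^-1` G))) L.
Proof.
move=> [_ _ ldp] oG Gx IL L' LL'.
have [+ _ _] := ldp _ (borel_open oG).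
have -> : interior G = G by exact/interior_id.
move=> /(lt_le_trans _) => /(_ (- L')%:E) lb.
have : ((- L')%:E < - ereal_inf (I @` G))%E.
  rewrite EFinN lteN2; apply: (@le_lt_trans _ _ (I x)).
    by apply: ereal_inf_lbound; exists x.
  by apply: le_lt_trans IL _; rewrite lte_fin.
move=> /lb /limn_einf_gt h; near=> n.
have n0 : (N0 <= n)%N by near: n.
have mE := random_element_preimage (meta n0) (borel_open oG).
rewrite -lne_ge_rate ?s_gt0 ?fine_prob_ge0// -fine_prob_fin//.
by apply/ltW; near: n.
Unshelve. all: by end_near. Qed.

(** A Borel set lies between its interior and its closure, so upper bounds on closed sets and lower
    bounds at single points of open sets suffice. *)
Lemma decay_growth_LDP :
  (forall x, (0 <= I x)%E) -> lower_semicontinuous I ->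
  (forall (F : set S) (L : R), closed F -> (L%:E < ereal_inf (I @` F))%E ->
    decay s (fun n => fine (P n (@eta n @^-1` F))) L) ->
  (forall (G : set S) (x : S) (L : R), open G -> G x -> (I x <= L%:E)%E ->
    growth s (fun n => fine (P n (@eta n @^-1` G))) L) ->
  LDP P (@eta) s I.
Proof.
move=> I0 lscI up lo; split=> // G bG u; split; last 2 first.
- exact: limn_einf_sup.
- apply: limn_esup_le => a; rewrite lteNl -EFinN => /ereal_between[L /andP[aL LI]].
  have := up _ _ (@closed_closure _ G) LI (- a); rewrite lte_fin in aL => /(_ aL) h.
  near=> n; have n0 : (N0 <= n)%N by near: n.
  have mG := random_element_preimage (meta n0) bG.
  have mF := random_element_preimage (meta n0) (borel_closed (@closed_closure _ G)).
  rewrite /u (fine_prob_fin _ mG) -[a]opprK lne_le_rate ?s_gt0 ?fine_prob_ge0//.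
  apply: (@le_trans _ _ (fine (P n (@eta n @^-1` closure G)))); last by near: n.
  by apply: le_fine_prob => // t; exact: subset_closure.
- apply: limn_einf_ge => a; rewrite lteNr -EFinN => /ereal_inf_lt[_ [x Gx <-]].
  move=> /ereal_between[L /andP[IL La]]; rewrite lte_fin in La.
  have := lo _ x L (@open_interior _ G) Gx (ltW IL) _ La => h.
  near=> n; have n0 : (N0 <= n)%N by near: n.
  have mG := random_element_preimage (meta n0) bG.
  have mF := random_element_preimage (meta n0) (borel_open (@open_interior _ G)).
  rewrite /u (fine_prob_fin _ mG) -[a]opprK lne_ge_rate ?s_gt0 ?fine_prob_ge0//.
  apply: (@le_trans _ _ (fine (P n (@eta n @^-1` interior G)))); first by near: n.
  by apply: le_fine_prob => // t; exact: interior_subset.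
Unshelve. all: by end_near. Qed.

End LDP_log_scale.

Lemma enorm2E (R : realType) (k : nat) (x : 'cV[R]_k) :
  enorm2 x = Num.sqrt (sqnorm x).
Proof. by []. Qed.

Lemma enorm2_ge0 (R : realType) (k : nat) (x : 'cV[R]_k) : 0 <= enorm2 x.
Proof. exact: sqrtr_ge0. Qed.

Lemma sqr_enorm2 (R : realType) (k : nat) (x : 'cV[R]_k) :
  enorm2 x ^+ 2 = sqnorm x.
Proof. by rewrite sqr_sqrtr// sqnorm_ge0. Qed.

Lemma enorm2Z (R : realType) (k : nat) (a : R) (x : 'cV[R]_k) :
  enorm2 (a *: x) = `|a| * enorm2 x.
Proof. by rewrite !enorm2E sqnormZ sqrtrM ?sqr_ge0// sqrtr_sqr. Qed.

Lemma enorm2_coord (R : realType) (k : nat) (x : 'cV[R]_k) l :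
  `|x l 0| <= enorm2 x.
Proof.
rewrite -sqrtr_sqr ler_wsqrtr// (bigD1 l)//= lerDl.
by apply: sumr_ge0 => i _; exact: sqr_ge0.
Qed.

Lemma enorm2_eq0 (R : realType) (k : nat) (x : 'cV[R]_k) :
  (enorm2 x == 0) = (x == 0).
Proof.
apply/idP/idP => [/eqP x0|/eqP->].
  apply/eqP/matrixP => l j; rewrite ord1 [RHS]mxE; apply/eqP.
  by rewrite -normr_le0 -x0 enorm2_coord.
by rewrite /enorm2 big1 ?sqrtr0// => l _; rewrite mxE expr0n.
Qed.

Lemma enorm2_gt0 (R : realType) (k : nat) (x : 'cV[R]_k) :
  (0 < enorm2 x) = (x != 0).
Proof. by rewrite lt_neqAle enorm2_ge0 andbT eq_sym enorm2_eq0. Qed.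

Lemma enorm2_continuous (R : realType) (k : nat) :
  continuous (@enorm2 R k).
Proof.
move=> x; rewrite /enorm2.
apply: (@continuous_comp _ _ _ (fun x : 'cV[R]_k => \sum_l x l 0 ^+ 2) Num.sqrt);
  last exact: sqrt_continuous.
apply: (@cvg_big _ _ _ _ _ _ _ (nbhs x) _ _ (fun l => x l 0 ^+ 2)) => [|l _].
  exact: add_continuous.
rewrite expr2; under eq_cvg do rewrite expr2.
by apply: cvgM; exact: coord_continuous.
Qed.

Lemma enorm2_ball_compact (R : realType) (k : nat) (b : R) :
  compact [set x : 'cV[R]_k | enorm2 x <= b].
Proof.
have -> : [set x : 'cV[R]_k | enorm2 x <= b] =
    trmx @` [set y : 'rV[R]_k | enorm2 y^T <= b].
  apply/seteqP; split => [x xb|_ [y yb <-]] //.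
  by exists x^T; rewrite /= trmxK.
have tr_cont m n : continuous (@trmx R m n).
  move=> y B [Q yQ QB]; exists (fun i j => Q j i) => [i j|z zQ].
    by have := yQ j i; rewrite mxE.
  by apply: QB => i j; rewrite mxE; exact: zQ.
apply: continuous_compact; first exact/continuous_subspaceT/tr_cont.
apply: bounded_closed_compact.
  exists b; split; first exact: num_real.
  move=> M bM y /= yb; rewrite [leLHS]mx_normrE.
  apply: bigmax_le; first by rewrite (le_trans _ (ltW bM))// (le_trans _ yb)// enorm2_ge0.
  move=> [i j] _ /=; rewrite ord1 (le_trans _ (ltW bM))// (le_trans _ yb)//.
  by have := enorm2_coord y^T j; rewrite mxE.
apply: (@closed_comp _ _ (fun y : 'rV[R]_k => enorm2 y^T) [set z | z <= b]).
  by move=> y _; apply: continuous_comp; [exact: tr_cont|exact: enorm2_continuous].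
exact: closed_le.
Qed.

(** * Radial rate functions *)

(** Parametrizing by the cost y instead of the norm c = g y lets both regimes share one argument. *)
Definition radial_cost (R : realType) (J : R -> \bar R) (g : R -> R) (a : R) : \bar R :=
  ereal_inf [set (J (a / g y)%R + y%:E)%E | y in [set y : R | 0 < y]].

Definition radial_rate (R : realType) (k : nat) (J : R -> \bar R) (g : R -> R)
    (x : 'cV[R]_k) : \bar R :=
  if x == 0 then 0%E else radial_cost J g (enorm2 x).

(* [g y] is the norm of the projected direction which has cost [y]. *)
Record cost_scale (R : realType) (g : R -> R) : Prop := CostScale {
  cost_scale0 : g 0 = 0;
  cost_scale_lt : forall y y' : R, 0 <= y -> y < y' -> g y < g y';
  cost_scale_onto : forall c y : R, 0 < c -> 0 < y -> c <= g y ->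
    exists2 y', 0 < y' <= y & g y' = c;
  cost_scale_dilate : forall L e : R, 0 < L -> 0 < e ->
    exists2 th, 1 < th & forall y, 0 < y < L -> th * g y <= g (y + e) }.

Section radial_rate.
Context {R : realType} {k : nat}.
Variables (J : R -> \bar R) (g : R -> R).
Hypothesis J0 : forall r, (0 <= J r)%E.
Hypothesis gP : cost_scale g.

Let g_gt0 (y : R) : 0 < y -> 0 < g y.
Proof. by move=> y0; rewrite -(cost_scale0 gP); exact: cost_scale_lt. Qed.

Lemma radial_cost_geP (a : R) (L : \bar R) :
  (L <= radial_cost J g a)%E <->
  forall y : R, 0 < y -> (L <= J (a / g y)%R + y%:E)%E.
Proof.
split=> [La y y0|H].
  by apply: le_trans La _; apply: ereal_inf_lbound; exists y.
by apply: le_ereal_inf_tmp => _ [y y0 <-]; exact: H.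
Qed.

Lemma radial_cost_ge0 (a : R) : (0 <= radial_cost J g a)%E.
Proof. by apply/radial_cost_geP => y y0; rewrite adde_ge0// lee_fin ltW. Qed.

(** A competitor y for b yields one for a: the y' <= y with g y' = (a / b) g y gives the same
    argument to [J] and costs no more. *)
Lemma radial_cost_mono (a b : R) : 0 < a -> a <= b ->
  (radial_cost J g a <= radial_cost J g b)%E.
Proof.
move=> a0 ab; have b0 : 0 < b by exact: lt_le_trans ab.
apply/radial_cost_geP => y y0; have gy := g_gt0 y0.
have [||y' /andP[y'0 y'y] gy'] := @cost_scale_onto _ _ gP (a / b * g y) y _ y0.
- by rewrite mulr_gt0// divr_gt0.
- by rewrite ger_pMl// ler_pdivrMr// mul1r.
apply: (@le_trans _ _ (J (a / g y')%R + y'%:E)%E).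
  by apply: ereal_inf_lbound; exists y'.
rewrite gy' leeD ?lee_fin//.
have -> // : a / (a / b * g y) = b / g y.
by field; rewrite !gt_eqF.
Qed.

(** Dilation enters here: scaling a down by th is undone by moving y to some y' <= y + (L1 - L),
    which costs at most the gap between L1 and L. Values y >= L already cost L by themselves. *)
Lemma radial_cost_left (a L : R) : 0 < a -> (L%:E < radial_cost J g a)%E ->
  exists2 a', 0 < a' < a & (L%:E <= radial_cost J g a')%E.
Proof.
move=> a0 /ereal_between[L1 /andP[LL1 L1a]]; rewrite lte_fin in LL1.
have [L0|L0] := leP L 0.
  exists (a / 2); first by apply/andP; split; lra.
  by rewrite (le_trans _ (radial_cost_ge0 _)).
have [|th th1 thP] := @cost_scale_dilate _ _ gP L (L1 - L) L0.
  by rewrite subr_gt0.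
have th0 : 0 < th by lra.
exists (a / th); first by rewrite divr_gt0//= ltr_pdivrMr// ltr_pMr.
apply/radial_cost_geP => y y0; have [yL|Ly] := ltP y L; last first.
  by rewrite -[L%:E]add0e leeD ?lee_fin.
have gy := g_gt0 y0.
have [|||y' /andP[y'0 y'y] gy'] := @cost_scale_onto _ _ gP (th * g y) (y + (L1 - L)).
- by rewrite mulr_gt0.
- by lra.
- by apply: thP; rewrite y0.
have : (L1%:E <= J (a / g y')%R + y'%:E)%E.
  by apply: le_trans (ltW L1a) _; apply: ereal_inf_lbound; exists y'.
rewrite gy'; have -> : a / (th * g y) = a / th / g y by field; rewrite !gt_eqF.
move=> h; rewrite -(leeD2rE (x := (L1 - L)%:E)) // -EFinD addrCA subrr addr0.
by apply: le_trans h _; rewrite -addeA leeD2l// -EFinD lee_fin.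
Qed.

Lemma radial_rate_ge0 (x : 'cV[R]_k) : (0 <= radial_rate J g x)%E.
Proof. by rewrite /radial_rate; case: ifPn => // _; exact: radial_cost_ge0. Qed.

Lemma radial_rate_lsc : lower_semicontinuous (radial_rate (k := k) J g).
Proof.
move=> x a; rewrite /radial_rate; case: ifPn => [_|x0].
  rewrite lte_fin => a0; exists setT; first exact: filterT.
  move=> y _; apply: lt_le_trans (radial_rate_ge0 y); by rewrite lte_fin.
move=> /ereal_between[L /andP[aL Lx]].
have [|a' /andP[a'0 a'x] La'] := radial_cost_left _ Lx; first by rewrite enorm2_gt0.
exists [set y : 'cV[R]_k | a' < enorm2 y].
  apply: (@cvgr_gt _ _ (nbhs x) _ (@enorm2 R k)) a'x; exact: enorm2_continuous.
move=> y /= a'y; rewrite ifF; last first.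
  by apply/negbTE; rewrite -enorm2_gt0; exact: lt_trans a'y.
apply: lt_le_trans aL _; apply: le_trans La' _.
exact: radial_cost_mono (ltW a'y).
Qed.

Hypothesis goodJ : good_rate J.

(** A near-optimal pair has y < a + 1 and r in the level set of [J] at a + 1, which is bounded. The
    extra 1 leaves room for an infimum that is not attained. *)
Lemma radial_rate_bounded (a : R) : exists b, forall x : 'cV[R]_k,
  (radial_rate J g x <= a%:E)%E -> enorm2 x <= b.
Proof.
have [a0|a0] := ltP a 0.
  exists 0 => x xa; have := le_trans (radial_rate_ge0 x) xa.
  by rewrite lee_fin leNgt a0.
have /(@compact_bounded R R^o)[B [_ BP]] := @goodJ (a + 1).
pose B' := Num.max B 0 + 1.
have B'0 : 0 < B' by rewrite ltr_pwDr// le_max lexx orbT.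
have BB' : B < B' by rewrite /B' ltr_pwDr// le_max lexx.
exists (B' * g (a + 1)) => x; rewrite /radial_rate; case: ifPn => [/eqP-> _|x0 xa].
  by move/eqP: (enorm2_eq0 (0 : 'cV[R]_k)); rewrite eqxx => /eqP/eqP->; rewrite mulr_ge0 ?(ltW B'0)// ltW// g_gt0//; lra.
have : (radial_cost J g (enorm2 x) < (a + 1)%:E)%E.
  by apply: le_lt_trans xa _; rewrite lte_fin; lra.
move=> /ereal_inf_lt[_ [y y0 <-]] /=; set r := enorm2 x / g y => h.
have ya : y < a + 1.
  rewrite -lte_fin; apply: le_lt_trans h.
  by rewrite -[leLHS]add0e leeD.
have Jr : (J r <= (a + 1)%:E)%E.
  by apply/ltW; apply: le_lt_trans h; rewrite -[leLHS]adde0 leeD// lee_fin ltW.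
have := BP _ BB' r Jr => rB.
have gy := g_gt0 y0.
rewrite -[enorm2 x](divfK (lt0r_neq0 gy)) ler_pM ?divr_ge0 ?enorm2_ge0 ?(ltW gy)//.
  by apply: le_trans rB; exact: ler_norm.
by apply/ltW; apply: cost_scale_lt => //; exact: ltW.
Qed.

Lemma radial_rate_good : good_rate (radial_rate (k := k) J g).
Proof.
move=> a; have [b bP] := radial_rate_bounded a.
apply: subclosed_compact (@enorm2_ball_compact R k b) _; last by move=> x /bP.
have -> : [set x : 'cV[R]_k | (radial_rate J g x <= a%:E)%E] =
    ~` [set x | (a%:E < radial_rate J g x)%E].
  by apply/seteqP; split => x /=; rewrite leNgt => /negP.
apply: open_closedC; move: a {b bP}; apply/lower_semicontinuousP.
exact: radial_rate_lsc.
Qed.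

(* A closed set which avoids the origin has a point of smallest norm. *)
Lemma closed_radial_cost (F : set 'cV[R]_k) (L : R) : closed F -> ~ F 0 -> F !=set0 ->
  (L%:E < ereal_inf (radial_rate J g @` F))%E ->
  exists a, [/\ 0 < a, (L%:E < radial_cost J g a)%E & forall x, F x -> a <= enorm2 x].
Proof.
move=> cF F0 [x0 Fx0] LF.
pose K := F `&` [set x | enorm2 x <= enorm2 x0].
have cK : compact K.
  rewrite /K setIC; apply: compact_closedI => //; exact: enorm2_ball_compact.
have [||c /set_mem[Fc cx0] cmin] := @compact_EVT_min _ R (@enorm2 R k) K _ cK.
- by exists x0; split => /=.
- by apply: continuous_subspaceT; exact: enorm2_continuous.
have c0 : c != 0 by apply: contra_notN F0 => /eqP <-.
exists (enorm2 c); split; first by rewrite enorm2_gt0.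
- apply: lt_le_trans LF _; apply: ereal_inf_lbound; exists c => //.
  by rewrite /radial_rate (negPf c0).
- move=> x Fx; have [xx0|/ltW xx0] := leP (enorm2 x) (enorm2 x0).
    by apply: cmin; apply/mem_set.
  exact: le_trans cx0 xx0.
Qed.

End radial_rate.

(** * LDP for the product of an independent radius and direction *)

Section product_LDP.
Context {R : realType} {k : nat} {d : nat -> measure_display}
  {T : forall n, measurableType (d n)}.
Variables (P : forall n, probability (T n) R) (s : nat -> R) (N0 : nat)
  (rho : forall n, T n -> R) (Z eta : forall n, T n -> 'cV[R]_k)
  (J : R -> \bar R) (g : R -> R).
Hypothesis s_gt0 : forall n, (N0 <= n)%N -> 0 < s n.
Hypothesis s_oo : s n @[n --> \oo] --> +oo.
Hypothesis mrho : forall n, (N0 <= n)%N -> measurable_fun setT (@rho n).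
Hypothesis mZ : forall n, (N0 <= n)%N -> random_element (@Z n).
Hypothesis rho_ge0 : forall n t, 0 <= @rho n t.
Hypothesis etaE : forall n, (N0 <= n)%N -> forall t, @eta n t = rho t *: Z t.
Hypothesis rhoZ_indep : forall n, (N0 <= n)%N ->
  forall (B : set R) (C : set 'cV[R]_k), measurable B -> borel C ->
  P n (@rho n @^-1` B `&` @Z n @^-1` C) =
  (P n (@rho n @^-1` B) * P n (@Z n @^-1` C))%E.
Hypothesis ldpJ : LDP_good P (@rho) s J.
Hypothesis gP : cost_scale g.
Hypothesis Z_decay : forall y : R, 0 < y ->
  decay s (fun n => fine (P n (@Z n @^-1` [set z | g y <= enorm2 z]))) y.
Hypothesis Z_growth : forall (y e : R) (v : 'cV[R]_k), 0 < y -> 0 < e -> enorm2 v = 1 ->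
  growth s (fun n => fine (P n (@Z n @^-1` ball (g y *: v) e))) y.

Let near_N0 : \forall n \near \oo, (N0 <= n)%N.
Proof. by exists N0. Qed.

Let J0 r : (0 <= J r)%E.
Proof. by case: ldpJ => -[]. Qed.

Let g_gt0 (y : R) : 0 < y -> 0 < g y.
Proof. by move=> y0; rewrite -(cost_scale0 gP); exact: cost_scale_lt. Qed.

Let rho_random n : (N0 <= n)%N -> random_element (@rho n).
Proof.
move=> n0; apply: (@measurability _ _ (T n) (borelType R) setT (@rho n) open) => //.
by move=> _ [U oU <-]; apply: mrho => //; exact: open_measurable.
Qed.

Let eta_random n : (N0 <= n)%N -> random_element (@eta n).
Proof.
move=> n0; have -> : @eta n = fun t => rho t *: Z t by apply/funext => t; exact: etaE.
by apply: measurable_scalemx; [exact: mrho|exact: mZ].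
Qed.

Let fine_indep n (B : set R) (C : set 'cV[R]_k) : (N0 <= n)%N ->
  measurable B -> borel C ->
  fine (P n (@rho n @^-1` B `&` @Z n @^-1` C)) =
  fine (P n (@rho n @^-1` B)) * fine (P n (@Z n @^-1` C)).
Proof.
move=> n0 mB bC; rewrite rhoZ_indep// fineM// fin_num_measure//.
  by rewrite -[X in measurable X]setTI; exact: mrho.
by apply: random_element_preimage bC; exact: mZ.
Qed.

Let rho_decay (a L : R) : (forall r, a <= r -> (L%:E <= J r)%E) ->
  decay s (fun n => fine (P n (@rho n @^-1` `[a, +oo[%classic))) L.
Proof.
move=> aL; have [ldp _] := ldpJ.
apply: (LDP_decay s_gt0 rho_random ldp); first exact: interval_closed.
by move=> r /=; rewrite in_itv /= andbT; exact: aL.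
Qed.

Let rho_growth (r e j : R) : 0 < e -> (J r <= j%:E)%E ->
  growth s (fun n => fine (P n (@rho n @^-1` ball r e))) j.
Proof.
move=> e0 Jr; have [ldp _] := ldpJ.
have oB : open (ball r e) by exact: ball_open.
by apply: (LDP_growth s_gt0 rho_random ldp oB _ Jr); exact: ballxx.
Qed.

(** The infimum of [J] is 0: otherwise the upper bound on the whole space would force the
    probability 1 to decay. The value 0 of the rate at the origin rests on this. *)
Let J_small (L : R) : 0 < L -> exists2 r, (0 <= J r)%E & (J r < L%:E)%E.
Proof.
move=> L0; apply: contrapT => H.
have JL r : (L%:E <= J r)%E.
  by rewrite leNgt; apply/negP => rL; apply: H; exists r.
have : decay s (fun n => fine (P n (@rho n @^-1` setT))) L.
  have [ldp _] := ldpJ.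
  exact: (LDP_decay s_gt0 rho_random ldp closedT).
move=> /(_ (L / 2)) []; first by lra.
move=> N _ HN.
have [M _ HM] := near_s_ge s_oo 1.
pose n := (maxn N (maxn M N0)).
have := HN n (leq_maxl _ _); rewrite /= preimage_setT probability_setT /=.
have sn : 1 <= s n by apply: HM => /=; rewrite /n; lia.
by apply/negP; rewrite -ltNge expR_lt1 oppr_lt0; nra.
Qed.

(** When |Z| is between g y and g y', the event |eta| >= a forces rho >= a / g y'. Every r in that
    range is a / g w with w <= y', so J r >= L - w >= L - y', and independence adds the rates. *)
Let eta_cell_decay (a y y' L : R) : 0 < a -> 0 <= y -> y < y' ->
  (L%:E <= radial_cost J g a)%E ->
  decay s (fun n => fine (P n (@rho n @^-1` `[a / g y', +oo[%classic `&`
    @Z n @^-1` [set z | g y <= enorm2 z]))) (y + (L - y')).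
Proof.
move=> a0 y0 yy' La; have y'0 : 0 < y' by exact: le_lt_trans yy'.
have gy' := g_gt0 y'0.
have bC : borel [set z : 'cV[R]_k | g y <= enorm2 z].
  apply: borel_closed; apply: (closed_comp _ (@closed_ge _ (g y))) => z _.
  exact: enorm2_continuous.
apply: (@decay_le _ _ (fun n => fine (P n (@Z n @^-1` [set z | g y <= enorm2 z])) *
    fine (P n (@rho n @^-1` `[a / g y', +oo[%classic)))) => //.
  near=> n; have n0 : (N0 <= n)%N by near: n.
  by rewrite fine_indep// mulrC.
apply: decayM; [by move=> n; exact: fine_prob_ge0|by move=> n; exact: fine_prob_ge0| |].
  move: y0; rewrite le_eqVlt => /predU1P[<-|]; last exact: Z_decay.
  apply: decay_le1 => //; near=> n; have n0 : (N0 <= n)%N by near: n.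
  apply: fine_prob_le1; apply: (random_element_preimage (mZ n0)).
  by apply: borel_closed; apply: (closed_comp _ (@closed_ge _ (g 0))) => z _; exact: enorm2_continuous.
apply: rho_decay => r ar; have r0 : 0 < r.
  by apply: lt_le_trans ar; rewrite divr_gt0.
have [||w /andP[w0 wy'] gw] := @cost_scale_onto _ _ gP (a / r) y' _ y'0.
- by rewrite divr_gt0.
- by rewrite ler_pdivrMr// mulrC -ler_pdivrMr.
move/radial_cost_geP : La => /(_ w w0); rewrite gw.
have -> : a / (a / r) = r by field; rewrite !gt_eqF.
move=> h; rewrite EFinB leeBlDr//; apply: le_trans h _.
by rewrite leeD2l// lee_fin.
Unshelve. all: by end_near. Qed.

(* The range of [|Z|] is cut at the levels [g (i e)], so that the cost of
   each cell is known up to [e]. *)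
Let eta_decay (a L : R) : 0 < a -> (L%:E < radial_cost J g a)%E ->
  decay s (fun n => fine (P n (@eta n @^-1` [set x | a <= enorm2 x]))) L.
Proof.
move=> a0 La.
have closedC (c : R) : closed [set z : 'cV[R]_k | c <= enorm2 z].
  apply: (closed_comp _ (@closed_ge _ c)) => z _; exact: enorm2_continuous.
have openC (c : R) : open [set z : 'cV[R]_k | enorm2 z < c].
  apply: (open_comp _ (@open_lt _ c)) => z _; exact: enorm2_continuous.
have mC c n : (N0 <= n)%N -> measurable (@Z n @^-1` [set z | c <= enorm2 z]).
  by move=> n0; apply: (random_element_preimage (mZ n0)); exact: borel_closed.
have mCo c n : (N0 <= n)%N -> measurable (@Z n @^-1` [set z | enorm2 z < c]).
  by move=> n0; apply: (random_element_preimage (mZ n0)); exact: borel_open.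
have mE n : (N0 <= n)%N -> measurable (@eta n @^-1` [set x | a <= enorm2 x]).
  by move=> n0; apply: (random_element_preimage (eta_random n0)); exact: borel_closed.
have mrho' c n : (N0 <= n)%N -> measurable (@rho n @^-1` `[c, +oo[%classic).
  by move=> n0; rewrite -[X in measurable X]setTI; exact: mrho.
suff H e : 0 < e ->
    decay s (fun n => fine (P n (@eta n @^-1` [set x | a <= enorm2 x]))) (L - e).
  move=> L' L'L; apply: (H ((L - L') / 2)); lra.
move=> e0; pose y (i : nat) : R := i%:R * e.
have y_ge0 i : 0 <= y i by rewrite mulr_ge0// ltW.
have y_lt i : y i < y i.+1 by rewrite /y ltr_pM2r// ltr_nat.
have cells N : decay s (fun n => fine (P n (@eta n @^-1` [set x | a <= enorm2 x]
    `&` @Z n @^-1` [set z | enorm2 z < g (y N)]))) (L - e).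
  elim: N => [|N IH].
    apply: (@decay_le _ _ (fun=> 0) _ (L - e)) => //.
      apply: nearW => n; rewrite (_ : _ `&` _ = set0) ?measure0//.
      apply/seteqP; split => // t [_] /=.
      by rewrite /y mul0r (cost_scale0 gP) ltNge enorm2_ge0.
    by move=> L' _; apply: nearW => n; exact: expR_ge0.
  have c1 := eta_cell_decay a0 (y_ge0 N) (y_lt N) (ltW La).
  have -> : L - e = y N + (L - y N.+1) by rewrite /y -natr1; ring.
  have {}IH : decay s (fun n => fine (P n (@eta n @^-1` [set x | a <= enorm2 x]
    `&` @Z n @^-1` [set z | enorm2 z < g (y N)]))) (y N + (L - y N.+1)).
    by have -> : y N + (L - y N.+1) = L - e by rewrite /y -natr1; ring.
  apply: decay_le (decayD s_oo IH c1) => //.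
  near=> n; have n0 : (N0 <= n)%N by near: n.
  apply: le_trans (fine_probU_le _ _ _); last 2 first.
  - by apply: measurableI; [exact: mE|exact: mCo].
  - by apply: measurableI; [exact: mrho'|exact: mC].
  apply: le_fine_prob.
  - by apply: measurableI; [exact: mE|exact: mCo].
  - apply: measurableU; apply: measurableI; by [exact: mE|exact: mCo|exact: mrho'|exact: mC].
  - move=> t [at_ /= zt]; have [zl|zg] := ltP (enorm2 (Z t)) (g (y N)); first by left.
    right; split => //=; rewrite in_itv /= andbT.
    have gN : 0 < g (y N.+1) by apply: g_gt0; exact: le_lt_trans (y_lt N).
    rewrite ler_pdivrMr//; apply: le_trans at_ _.
    by rewrite etaE// enorm2Z ger0_norm// ler_wpM2l// ltW.
(* Beyond the level g (y N) the cost of Z alone is at least L, so finitely many cells suffice. The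
   successor also keeps y N positive. *)
pose N := (Num.trunc (Num.max L 0 / e)).+1.
have LyN : L <= y N.
  rewrite /y -ler_pdivrMr//; apply: le_trans (ltW (truncnS_gt _)).
  by rewrite ler_pM2r ?invr_gt0// le_max lexx.
have yN0 : 0 < y N by rewrite /y mulr_gt0.
have last : decay s (fun n => fine (P n (@Z n @^-1` [set z | g (y N) <= enorm2 z]))) (L - e).
  apply: decay_le (Z_decay yN0); first exact: nearW.
  by apply: le_trans LyN; rewrite gerBl ltW.
apply: decay_le (decayD s_oo (cells N) last) => //.
near=> n; have n0 : (N0 <= n)%N by near: n.
apply: le_trans (fine_probU_le _ _ _); last 2 first.
- by apply: measurableI; [exact: mE|exact: mCo].
- exact: mC.
apply: le_fine_prob; first exact: mE.
- by apply: measurableU; [apply: measurableI; [exact: mE|exact: mCo]|exact: mC].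
- by move=> t at_; have [zl|zg] := ltP (enorm2 (Z t)) (g (y N)); [left|right].
Unshelve. all: by end_near. Qed.

(** A radius r of cost below L' exists by [J_small]. The direction has only to be small, an event of
    rate 0 because its complement decays exponentially. *)
Let eta_growth0 (e L : R) : 0 < e -> 0 <= L ->
  growth s (fun n => fine (P n (@eta n @^-1` ball (0 : 'cV[R]_k) e))) L.
Proof.
move=> e0 L0 L' LL'.
have [r r0 rL'] := J_small (le_lt_trans L0 LL').
have rfin : J r = (fine (J r))%:E by rewrite fineK// ge0_fin_numE// (lt_trans rL')// ltry.
have r1 : 0 < `|r| + 1 by rewrite ltr_wpDl.
pose c := e / (`|r| + 1).
have c0 : 0 < c by rewrite divr_gt0.
have [y y0 gyc] : exists2 y, 0 < y & g y <= c.
  have [cg|gc] := leP c (g 1); last by exists 1 => //; exact: ltW.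
  have [y /andP[y0 _] gy] := @cost_scale_onto _ _ gP c 1 c0 ltr01 cg.
  by exists y => //; rewrite gy.
pose C := [set z : 'cV[R]_k | g y <= enorm2 z].
have bC : borel C.
  apply: borel_closed; apply: (closed_comp _ (@closed_ge _ (g y))) => z _.
  exact: enorm2_continuous.
have bC' : borel (~` C) by exact: (@measurableC _ (borelType 'cV[R]_k)).
have gZ := decay_growth_sub s_oo y0 (growth_cst s_oo ltr01) (Z_decay y0).
have gr : growth s (fun n => fine (P n (@rho n @^-1` ball r 1))) (fine (J r)).
  by apply: rho_growth => //; rewrite -rfin.
have {gr gZ} := growthM gr gZ; rewrite addr0 => /(_ L').
rewrite -lte_fin -rfin => /(_ rL') h; near=> n.
have n0 : (N0 <= n)%N by near: n.
apply: (@le_trans _ _ (fine (P n (@rho n @^-1` ball r 1)) *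
   (1 - fine (P n (@Z n @^-1` C))))); first by near: n.
have mb : measurable (ball r 1) by exact: measurable_ball.
apply: (@le_trans _ _ (fine (P n (@rho n @^-1` ball r 1 `&` @Z n @^-1` (~` C))))).
  rewrite fine_indep// ler_wpM2l ?fine_prob_ge0//.
  have mC := random_element_preimage (mZ n0) bC.
  by rewrite preimage_setC probability_setC// fineB// fin_num_measure.
apply: le_fine_prob.
- apply: measurableI; first by rewrite -[X in measurable X]setTI; exact: mrho.
  exact: (random_element_preimage (mZ n0)).
- by apply: (random_element_preimage (eta_random n0)); apply: borel_open; exact: ball_open.
- move=> t [/= rt /negP]; rewrite -ltNge => Zt; split => // i j.
  rewrite etaE// ord1 !mxE -ball_normE /= sub0r normrN normrM ger0_norm//.
  have rhot : rho t < `|r| + 1.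
    move: rt; rewrite -ball_normE /= distrC => rt.
    rewrite -(subrK r (rho t)) addrC; apply: ler_ltD (ler_norm _) _.
    exact: le_lt_trans (ler_norm _) rt.
  have Zi : `|Z t i 0| < c.
    by apply: le_lt_trans (enorm2_coord _ _) _; exact: lt_le_trans Zt gyc.
  rewrite -[ltRHS](divfK (lt0r_neq0 r1)) -/c [ltRHS]mulrC.
  by rewrite ltr_pM.
Unshelve. all: by end_near. Qed.

Let eta_growth (x : 'cV[R]_k) (e L : R) : 0 < e -> (radial_rate J g x <= L%:E)%E ->
  growth s (fun n => fine (P n (@eta n @^-1` ball x e))) L.
Proof.
move=> e0; rewrite /radial_rate; case: ifPn => [/eqP-> |x0].
  by rewrite lee_fin; exact: eta_growth0.
move=> xL L' LL'.
have : (radial_cost J g (enorm2 x) < L'%:E)%E.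
  by apply: le_lt_trans xL _; rewrite lte_fin.
move=> /ereal_inf_lt[_ [y y0 <-]] /=; set r := enorm2 x / g y => yL'.
have rfin : J r = (fine (J r))%:E.
  rewrite fineK// ge0_fin_numE//; apply: (@le_lt_trans _ _ (J r + y%:E)%E).
    by rewrite leeDl// lee_fin ltW.
  by apply: lt_trans yL' _; rewrite ltry.
have gy := g_gt0 y0.
have ex0 : 0 < enorm2 x by rewrite enorm2_gt0.
have r0 : 0 < r by rewrite divr_gt0.
pose v := (enorm2 x)^-1 *: x.
have v1 : enorm2 v = 1.
  by rewrite /v enorm2Z ger0_norm ?invr_ge0 ?enorm2_ge0// mulVf// gt_eqF.
have xE : x = r *: (g y *: v).
  by rewrite /v !scalerA /r divfK ?gt_eqF// mulfV ?gt_eqF// scale1r.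
have D0 : 0 < g y + 1 + r by rewrite !addr_gt0.
(* From |r w - rho z| <= r |w - z| + |r - rho| |z|, with |z| <= g y + 1 because dlt <= 1, this
   choice keeps the product within e. *)
pose dlt := Num.min 1 (e / (g y + 1 + r)).
have dlt0 : 0 < dlt by rewrite lt_min ltr01 divr_gt0.
have dlt1 : dlt <= 1 by rewrite ge_min lexx.
have dltD : dlt * (g y + 1 + r) <= e.
  by rewrite -ler_pdivlMr// ge_min lexx orbT.
have gr : growth s (fun n => fine (P n (@rho n @^-1` ball r dlt))) (fine (J r)).
  by apply: rho_growth => //; rewrite -rfin.
have {gr} := growthM gr (Z_growth y0 dlt0 v1) => /(_ L').
rewrite -lte_fin EFinD -rfin => /(_ yL') h; near=> n.
have n0 : (N0 <= n)%N by near: n.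
apply: (@le_trans _ _ (fine (P n (@rho n @^-1` ball r dlt)) *
   fine (P n (@Z n @^-1` ball (g y *: v) dlt)))); first by near: n.
have mb : measurable (ball r dlt) by exact: measurable_ball.
have bB : borel (ball (g y *: v) dlt) by apply: borel_open; exact: ball_open.
rewrite -fine_indep//; apply: le_fine_prob.
- apply: measurableI; first by rewrite -[X in measurable X]setTI; exact: mrho.
  exact: (random_element_preimage (mZ n0)).
- by apply: (random_element_preimage (eta_random n0)); apply: borel_open; exact: ball_open.
- move=> t [/= rt [_ Zt]]; split => // i j.
  rewrite etaE// ord1 [x]xE; move: (Zt i 0); rewrite !mxE -!ball_normE /=.
  set w := g y * ((enorm2 x)^-1 * x i 0); set z := Z t i 0 => wz.
  have w1 : `|w| <= g y.
    rewrite /w normrM ger0_norm ?(ltW gy)// -[leRHS]mulr1 ler_wpM2l ?(ltW gy)//.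
    by rewrite -v1; have := enorm2_coord v i; rewrite mxE.
  have z1 : `|z| <= g y + 1.
    rewrite -[z](subrK w) (le_trans (ler_normD _ _))// addrC lerD// distrC.
    exact: le_trans (ltW wz) dlt1.
  move: rt; rewrite -ball_normE /= => rt.
  have -> : r * w - rho t * z = r * (w - z) + (r - rho t) * z by ring.
  apply: le_lt_trans (ler_normD _ _) _; apply: lt_le_trans dltD.
  rewrite (normrM r) (normrM (r - rho t)) (ger0_norm (ltW r0)).
  rewrite [ltRHS]mulrDr [ltLHS]addrC ler_ltD//.
    by rewrite ler_pM// ltW.
  by rewrite [ltRHS]mulrC ltr_pM2l.
Unshelve. all: by end_near. Qed.

Lemma product_LDP : LDP_good P (@eta) s (radial_rate (k := k) J g).
Proof.
have [ldp goodJ] := ldpJ; split; last exact: radial_rate_good.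
apply: (decay_growth_LDP s_gt0 eta_random).
- exact: radial_rate_ge0.
- exact: radial_rate_lsc.
- move=> F L cF LF.
  have near_le1 : \forall n \near \oo, fine (P n (@eta n @^-1` F)) <= 1.
    near=> n; have n0 : (N0 <= n)%N by near: n.
    apply: fine_prob_le1; apply: (random_element_preimage (eta_random n0)).
    exact: borel_closed.
  (* If F contains the origin, where the rate is 0, then L <= 0 and the bound of a probability by 1
     suffices. *)
  have [F0|F0] := pselect (F 0).
    apply: decay_le1 => //; rewrite -lee_fin; apply: le_trans (ltW LF) _.
    by apply: ereal_inf_lbound; exists 0 => //; rewrite /radial_rate eqxx.
  have [/set0P Fn0|/negPn/eqP F00] := boolP (F != set0); last first.
    move=> L' _; apply: nearW => n; rewrite F00 preimage_set0 measure0.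
    exact: expR_ge0.
  have [a [a0 La Fa]] := closed_radial_cost cF F0 Fn0 LF.
  apply: decay_le (eta_decay a0 La) => //.
  near=> n; have n0 : (N0 <= n)%N by near: n.
  apply: le_fine_prob; last by move=> t; exact: Fa.
    by apply: (random_element_preimage (eta_random n0)); exact: borel_closed.
  apply: (random_element_preimage (eta_random n0)); apply: borel_closed.
  by apply: (closed_comp _ (@closed_ge _ a)) => z _; exact: enorm2_continuous.
- move=> G x L oG Gx xL.
  have /nbhs_ballP[e /= e0 eG] : nbhs x G by exact: open_nbhs_nbhs.
  apply: growth_le (eta_growth e0 xL) => //.
  near=> n; have n0 : (N0 <= n)%N by near: n.
  apply: le_fine_prob; last by move=> t; exact: eG.
    by apply: (random_element_preimage (eta_random n0)); apply: borel_open; exact: ball_open.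
  by apply: (random_element_preimage (eta_random n0)); exact: borel_open.
Unshelve. all: by end_near. Qed.

End product_LDP.

(** * Projections of a Haar matrix *)

Section direction.
Context {R : realType} {n k : nat}.
Variable i0 : 'I_n.

(* The value at the origin is immaterial, as long as it is a unit vector. *)
Definition direction (x : 'cV[R]_n) : 'cV[R]_n :=
  (enorm2 x)^-1 *: x + (enorm2 x == 0)%:R *: delta_mx i0 0.

Lemma sqnorm_delta (i : 'I_n) : sqnorm (delta_mx i 0 : 'cV[R]_n) = 1.
Proof. by rewrite sqnormE trmx_delta mul_delta_mx mxE !eqxx. Qed.

Lemma sqnorm_direction (x : 'cV[R]_n) : sqnorm (direction x) = 1.
Proof.
rewrite /direction; have [x0|x0] := eqVneq (enorm2 x) 0.
  move/eqP: x0; rewrite enorm2_eq0 => /eqP ->.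
  by rewrite scaler0 add0r scale1r sqnorm_delta.
rewrite scale0r addr0 sqnormZ exprVn sqr_enorm2 mulVf//.
by rewrite -sqr_enorm2 sqrf_eq0.
Qed.

Lemma enorm2_direction (x : 'cV[R]_n) : enorm2 x *: direction x = x.
Proof.
rewrite /direction; have [x0|x0] := eqVneq (enorm2 x) 0.
  rewrite x0 scale0r; apply/esym/eqP.
  by rewrite -enorm2_eq0 x0.
by rewrite scale0r addr0 scalerA mulfV// scale1r.
Qed.

Lemma measurable_direction d (T : measurableType d) (X : T -> 'cV[R]_n) :
  random_element X -> random_element (fun t => direction (X t)).
Proof.
move=> mX; have mE := measurable_enorm2 mX.
apply: random_element_mx => i j; under eq_fun do rewrite !mxE.
apply: measurable_funD; apply: measurable_funM.
- under eq_fun do rewrite -powR_inv1 ?enorm2_ge0//.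
  exact: (measurableT_comp (measurable_powR (-1))).
- exact: measurable_coord.
- have -> : (fun t => (enorm2 (X t) == 0)%:R) =
      (\1_((fun t => enorm2 (X t)) @^-1` [set 0]) : T -> R).
    apply/funext => t; rewrite indicE; congr (_%:R); congr nat_of_bool.
    by apply/eqP/idP => [t0|/set_mem]//; apply/mem_set.
  apply: measurable_indic; rewrite -[X in measurable X]setTI.
  by apply: mE => //; exact: measurable_set1.
- exact: measurable_cst.
Qed.

Lemma haar_direction (mu : set 'M[R]_(n, k) -> \bar R) (u : 'cV[R]_n)
    (C : set 'cV[R]_k) :
  stiefel_haar mu -> sqnorm u = 1 -> borel C ->
  mu [set A | C (A^T *m u)] = mu [set A | C (A^T *m delta_mx i0 0)].
Proof.
move=> [_ muO] /sqnorm1_trmx /(orthogonal_to_unit i0)[W oW Wu] bC.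
have oW' : W^T^T *m W^T = 1%:M by rewrite trmxK; exact: mulmx1C.
rewrite -[RHS](muO W^T oW'); last first.
  apply: (random_element_preimage (T := borelType 'M[R]_(n, k)) _ bC).
  apply: measurable_mulmx; last exact: measurable_cst.
  by apply: measurable_trmx; exact: random_element_id.
congr mu; apply/seteqP; split => A /=;
  by rewrite trmx_mul trmxK -mulmxA Wu.
Qed.

End direction.

(** Fubini: for fixed X = x the inner probability concerns A^T u with u a unit vector, and by
    [haar_direction] it is the same for all x. *)
Lemma projection_indep (R : realType) (n k : nat) (i0 : 'I_n)
    d (T : measurableType d) (P : probability T R)
    (X : T -> 'cV[R]_n) (A : T -> 'M[R]_(n, k))
    (D : set 'cV[R]_n) (C : set 'cV[R]_k) :
  random_element X -> random_element A -> stiefel_haar (law P A) ->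
  independent P A X -> borel D -> borel C ->
  P (X @^-1` D `&` (fun t => (A t)^T *m direction i0 (X t)) @^-1` C) =
  (P (X @^-1` D) * law P A [set M : 'M[R]_(n, k) | C (M^T *m delta_mx i0 0%R)])%E.
Proof.
move=> mX mA haarA indAX bD bC.
pose X' : {mfun T >-> borelType 'cV[R]_n} :=
  HB.pack (X : T -> borelType 'cV[R]_n) (isMeasurableFun.Build _ _ _ _ _ mX).
pose A' : {mfun T >-> borelType 'M[R]_(n, k)} :=
  HB.pack (A : T -> borelType 'M[R]_(n, k)) (isMeasurableFun.Build _ _ _ _ _ mA).
pose XA t : borelType 'cV[R]_n * borelType 'M[R]_(n, k) := (X' t, A' t).
have mXA : measurable_fun setT XA by exact: measurable_fun_pair.
pose XA' : {mfun T >-> (borelType 'cV[R]_n * borelType 'M[R]_(n, k))%type} :=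
  HB.pack XA (isMeasurableFun.Build _ _ _ _ _ mXA).
pose E : set (borelType 'cV[R]_n * borelType 'M[R]_(n, k)) :=
  [set p | D p.1 /\ C ((p.2 : 'M[R]_(n, k))^T *m direction i0 (p.1 : 'cV[R]_n))].
have mE : measurable E.
  apply: measurableI.
    by rewrite -[X in measurable X]setTI; apply: measurable_fst.
  apply: (random_element_preimage _ bC); apply: measurable_mulmx.
    by apply: measurable_trmx; exact: measurable_snd.
  by apply: measurable_direction; exact: measurable_fst.
(* Independence says that the joint law agrees with the product measure on rectangles, which
   determines it. *)
have prodE : forall B1 B2, measurable B1 -> measurable B2 ->
    distribution P XA' (B1 `*` B2) = (distribution P X' B1 * distribution P A' B2)%E.
  move=> B1 B2 mB1 mB2; rewrite muleC -[RHS]indAX// setIC.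
  by congr (P _).
transitivity (distribution P XA' E); first by [].
rewrite -(product_measure_unique prodE mE) /product_measure1.
pose q := law P A [set M : 'M[R]_(n, k) | C (M^T *m delta_mx i0 0)].
rewrite -/q.
rewrite (eq_integral (fun x : borelType 'cV[R]_n =>
    q * (\1_(D : set (borelType 'cV[R]_n)) x)%:E)%E); last first.
  move=> x _ /=; rewrite indicE.
  have [/set_mem Dx|/negP Dx] := boolP (x \in D); last first.
    rewrite mule0 (_ : xsection E x = set0) ?measure0//.
    apply/seteqP; split => // M; rewrite /xsection /= => /set_mem [/= Dx' _].
    by apply: Dx; apply/mem_set.
  rewrite mule1 /q -(haar_direction i0 haarA (sqnorm_direction i0 x) bC).
  congr (P _); apply/seteqP; split => t; rewrite /xsection /=.
    by move=> /set_mem [].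
  by move=> Ct; apply/mem_set.
rewrite ge0_integralZl//.
- by rewrite integral_indic// setIT muleC.
- by apply/measurable_EFinP; exact: measurable_indic.
- by apply: measure_ge0.
Qed.

(** For one column, the mean of V under the measure tilted by V^(m+1): the quotient of two
    consecutive moments. *)
Definition tilted_mean (R : realType) (n m : nat) : R :=
  (2 * m.+1 + 1)%:R / (n + 2 * m.+1)%:R.

Section half_tail.
Context {R : realType} {n k : nat}.
Variable mu : probability (borelType 'M[R]_(n, k)) R.
Hypothesis haar_mu : stiefel_haar mu.
Variable i0 : 'I_n.
Variable v : 'cV[R]_k.
Hypothesis v1 : sqnorm v = 1.

Let mul_v_random : random_element (fun M : borelType 'M[R]_(n, k) => (M : 'M[R]_(n, k)) *m v).
Proof. by apply: measurable_mulmx; [exact: random_element_id|exact: measurable_cst]. Qed.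

Let mul_v : {mfun borelType 'M[R]_(n, k) >-> borelType 'M[R]_(n, 1)} :=
  HB.pack ((fun M => (M : 'M[R]_(n, k)) *m v) : borelType 'M[R]_(n, k) -> borelType 'M[R]_(n, 1))
    (isMeasurableFun.Build _ _ _ _ _ mul_v_random).

Let haar_mul_v : stiefel_haar (distribution mu mul_v).
Proof.
have [muV muO] := haar_mu; split.
  apply/eqP; rewrite eq_le; apply/andP; split.
    by apply: probability_le1; exact: stiefel_borel.
  rewrite -muV; apply: le_measure.
  - by rewrite inE; exact: stiefel_borel.
  - by rewrite inE; apply: (random_element_preimage mul_v_random); exact: stiefel_borel.
  - move=> M sM; rewrite /stiefel /= trmx_mul mulmxA -(mulmxA v^T) sM mulmx1.
    exact: sqnorm1_trmx.
move=> W oW B bB; rewrite /distribution /pushforward.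
have WE : mul_v @^-1` (mulmx W @^-1` B) = mulmx W @^-1` (mul_v @^-1` B).
  by apply/seteqP; split => M /=; rewrite mulmxA.
rewrite WE; exact: (muO W oW _ (random_element_preimage mul_v_random bB)).
Qed.

Lemma coord_ge_borel (c : R) : borel [set M : 'M[R]_(n, k) | c <= (M *m v) i0 0].
Proof.
have mc := measurable_coord i0 0 mul_v_random.
have := mc measurableT _ (measurable_itv `[c, +oo[%R).
by rewrite setTI; congr borel; apply/seteqP; split => M /=; rewrite in_itv /= andbT.
Qed.

(** For a unit v the column M v is Haar distributed on the sphere, so the one-column bound applies
    to it. The orthogonal matrix -1 exchanges the two signs of the coordinate, which turns the
    constant 4 into 8. *)
Lemma half_tail_ge (m : nat) (dlt c : R) : 0 < dlt -> 0 < c ->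
  4 <= (2 * m.+1 + 1)%:R * dlt ^+ 2 ->
  c ^+ 2 <= (1 - dlt) * tilted_mean R n m ->
  (1 - tilted_mean R n m) ^+ (n./2).+1 / (8 * m.+1%:R * (1 + dlt) ^+ m.+1) <=
  fine (mu [set M | c <= (M *m v) i0 0]).
Proof.
move=> dlt0 c0 mdlt cm.
pose Up := [set M : 'M[R]_(n, k) | c <= (M *m v) i0 0].
have mU : measurable (Up : set (borelType _)) by exact: coord_ge_borel.
have opp1 : ((-1)%:M)^T *m (-1)%:M = 1%:M :> 'M[R]_n.
  by rewrite tr_scalar_mx -scalar_mxM mulrNN mulr1.
pose Dn := mulmx ((-1)%:M : 'M[R]_n) @^-1` Up.
have mD : measurable (Dn : set (borelType _)).
  by rewrite /Dn -[X in measurable X]setTI; apply: measurable_mulmxl.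
have muD : mu Dn = mu Up by case: haar_mu => _ /(_ _ opp1 _ mU).
pose S := [set M : 'M[R]_(n, k) |
  (1 - dlt) * tilted_mean R n m <= row_gram i0 i0 (M *m v)].
have mS : measurable (S : set (borelType _)).
  exact: (random_element_preimage mul_v_random (row_gram_ge_borel i0 _)).
have S_le : fine (mu S) <= 2 * fine (mu Up).
  rewrite mulr2n mulrDl mul1r -{2}muD.
  apply: le_trans (fine_probU_le _ _ _) => //.
  apply: le_fine_prob => //; first exact: measurableU.
  move=> M; rewrite /S /= => /(le_trans cm).
  rewrite /row_gram big_ord1 -expr2 -(real_normK (num_real ((M *m v) i0 0))).
  rewrite ler_pXn2r ?nnegrE ?(ltW c0)// ler_normr => /orP[cM|cM]; [left|right] => //.
  by rewrite /Dn /Up /= mul_scalar_mx scaleN1r mulNmx mxE.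
have nv : (n <= 2 * (n./2).+1)%N by clear; lia.
have := row_tail_ge haar_mul_v i0 nv dlt0 mdlt.
rewrite -/(tilted_mean R n m).
move=> /le_trans /(_ S_le); rewrite -ler_pdivrMl//; apply: le_trans.
rewrite [leRHS]mulrC -[leRHS]mulrA; apply: ler_wpM2l.
  by rewrite exprn_ge0// subr_ge0 ler_pdivrMr ?mul1r ?ler_nat ?ltr0n; have := ltn_ord i0; lia.
by rewrite -invfM; have -> // : 4 * m.+1%:R * (1 + dlt) ^+ m.+1 * 2 =
  8 * m.+1%:R * (1 + dlt) ^+ m.+1 by ring.
Qed.

End half_tail.

Lemma decay_sup (R : realType) (s p : nat -> R) (L : R) :
  (forall e, 0 < e -> decay s p (L - e)) -> decay s p L.
Proof. by move=> H L' L'L; apply: (H ((L - L') / 2)); lra. Qed.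

Lemma growth_inf (R : realType) (s p : nat -> R) (L : R) :
  (forall e, 0 < e -> growth s p (L + e)) -> growth s p L.
Proof. by move=> H L' L'L; apply: (H ((L' - L) / 2)); lra. Qed.

Lemma growth_expR (R : realType) (s : nat -> R) (L : R) :
  s n @[n --> \oo] --> +oo -> growth s (fun n => expR (- (s n * L))) L.
Proof.
move=> s_oo L' LL'; have s0 := near_s_ge s_oo 0; near=> n.
have sn : 0 <= s n by near: n.
by rewrite ler_expR lerN2 ler_wpM2l// ltW.
Unshelve. all: by end_near. Qed.

Lemma decay_expR (R : realType) (s : nat -> R) (K L : R) :
  s n @[n --> \oo] --> +oo -> 0 < K -> decay s (fun n => K * expR (- (s n * L))) L.
Proof.
move=> s_oo K0 L' L'L; have sK := near_s_ge s_oo (K / (L - L')); near=> n.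
have -> : - (s n * L') = s n * (L - L') + (- (s n * L)) by ring.
rewrite expRD ler_wpM2r ?expR_ge0//; apply: le_trans (expR_ge1Dx _).
have : K / (L - L') <= s n by near: n.
by rewrite ler_pdivrMr ?subr_gt0//; lra.
Unshelve. all: by end_near. Qed.

(** exp (s L) >= (s L)^2 / 2 beats any affine function of s; for s >= 1 the latter is at most (a +
    b) s, whence the threshold. *)
Lemma growth_inv_affine (R : realType) (s : nat -> R) (a b : R) :
  s n @[n --> \oo] --> +oo -> 0 < a -> 0 < b ->
  growth s (fun n => (a * s n + b)^-1) 0.
Proof.
move=> s_oo a0 b0 L L0.
have s1 := near_s_ge s_oo 1.
have s2 := near_s_ge s_oo (2 * (a + b) / L ^+ 2); near=> n.
have sn1 : 1 <= s n by near: n.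
have sn2 : 2 * (a + b) <= s n * L ^+ 2.
  by rewrite -ler_pdivrMr ?exprn_gt0//; near: n.
have sL : 0 <= s n * L by rewrite mulr_ge0; lra.
rewrite expRN lef_pV2 ?posrE ?expR_gt0//; last nra.
apply: le_trans (expR_ge1Dxn 1 sL).
rewrite (_ : 2`!%:R = 2) // ler_wpDl// ler_pdivlMr// exprMn [_ ^+ 2 * _]mulrC.
have sn0 : 0 <= s n by lra.
have := ler_wpM2r sn0 sn2; nra.
Unshelve. all: by end_near. Qed.

Section projection.
Context {R : realType} {n k : nat} {d : measure_display} {T : measurableType d}.
Variables (P : probability T R) (i0 : 'I_n) (X : T -> 'cV[R]_n) (A : T -> 'M[R]_(n, k)).
Hypothesis mX : random_element X.
Hypothesis mA : random_element A.
Hypothesis haarA : stiefel_haar (law P A).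
Hypothesis indAX : independent P A X.
Variable tau : R.
Hypothesis tau0 : 0 < tau.

Let Z t := tau *: ((A t)^T *m direction i0 (X t)).

Let mu : {mfun T >-> borelType 'M[R]_(n, k)} :=
  HB.pack (A : T -> borelType 'M[R]_(n, k)) (isMeasurableFun.Build _ _ _ _ _ mA).

Let muA := distribution P mu.

Let haar_muA : stiefel_haar muA. Proof. exact: haarA. Qed.

Lemma random_projection : random_element Z.
Proof.
apply: measurable_scalemx; first exact: measurable_cst.
by apply: measurable_mulmx; [exact: measurable_trmx|exact: measurable_direction].
Qed.

Let scale_borel (C : set 'cV[R]_k) : borel C -> borel [set z | C (tau *: z)].
Proof.
move=> bC; apply: (random_element_preimage (T := borelType 'cV[R]_k) _ bC).
by apply: measurable_scalemx; [exact: measurable_cst|exact: measurable_id].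
Qed.

Let projection_law (C : set 'cV[R]_k) : borel C ->
  P (Z @^-1` C) = muA [set M | C (tau *: (M^T *m delta_mx i0 0))].
Proof.
move=> bC; have := projection_indep i0 mX mA haarA indAX
  (borel_open openT) (scale_borel bC).
by rewrite preimage_setT setTI probability_setT mul1e.
Qed.

Lemma projection_radius_indep (f : 'cV[R]_n -> R) (B : set R) (C : set 'cV[R]_k) :
  borel (f @^-1` B) -> borel C ->
  P ((fun t => f (X t)) @^-1` B `&` Z @^-1` C) =
  (P ((fun t => f (X t)) @^-1` B) * P (Z @^-1` C))%E.
Proof.
move=> bB bC; rewrite projection_law//.
exact: (projection_indep i0 mX mA haarA indAX bB (scale_borel bC)).
Qed.

Let tail_set (c : R) : 0 <= c ->
  [set M : 'M[R]_(n, k) | c <= enorm2 (tau *: (M^T *m delta_mx i0 0))] =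
  [set M | (c / tau) ^+ 2 <= row_gram i0 i0 M].
Proof.
move=> c0.
have E M : (c <= enorm2 (tau *: (M^T *m delta_mx i0 0))) =
    ((c / tau) ^+ 2 <= row_gram i0 i0 M).
  rewrite enorm2Z gtr0_norm// mulrC -ler_pdivrMr// -sqnorm_tr_delta -sqr_enorm2.
  by rewrite ler_pXn2r ?nnegrE ?divr_ge0 ?enorm2_ge0 ?(ltW tau0).
by apply/seteqP; split => M /=; rewrite E.
Qed.

Let borel_tail (c : R) : borel [set z : 'cV[R]_k | c <= enorm2 z].
Proof.
apply: borel_closed; apply: (closed_comp _ (@closed_ge _ c)) => z _.
exact: enorm2_continuous.
Qed.

Lemma projection_tail_le (l c : R) : (0 < k)%N -> (2 <= n)%N ->
  0 < l < 1 -> 0 <= c -> l * (c / tau) ^+ 2 < 1 ->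
  fine (P (Z @^-1` [set z | c <= enorm2 z])) <=
  ((1 - l) ^+ k)^-1 * (1 - l * (c / tau) ^+ 2) ^+ n./2.
Proof.
move=> k0 n2 l01 c0 lc; rewrite projection_law//= tail_set//.
have nE : n./2 = (n./2.-1).+1 by clear -n2; lia.
have kE : k = k.-1.+1 by rewrite prednK.
have vn : (2 * (n./2.-1).+1 <= n)%N by clear -n2; lia.
have := row_tail_le haar_muA i0 kE vn l01 (sqr_ge0 _) lc.
by rewrite -nE -kE.
Qed.

(** If <z, v> >= c and |z| < c', then |c v - z|^2 = c^2 - 2 c <z, v> + |z|^2 < c'^2 - c^2 <= e^2. So
    the half-space event minus the event |z| >= c' is contained in the ball. *)
Lemma projection_ball_ge (v : 'cV[R]_k) (c c' e dlt : R) (m : nat) :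
  enorm2 v = 1 -> 0 < c -> 0 < c' -> 0 < e -> c' ^+ 2 - c ^+ 2 <= e ^+ 2 ->
  0 < dlt -> 4 <= (2 * m.+1 + 1)%:R * dlt ^+ 2 ->
  (c / tau) ^+ 2 <= (1 - dlt) * tilted_mean R n m ->
  (1 - tilted_mean R n m) ^+ (n./2).+1 / (8 * m.+1%:R * (1 + dlt) ^+ m.+1) -
  fine (P (Z @^-1` [set z | c' <= enorm2 z])) <=
  fine (P (Z @^-1` ball (c *: v) e)).
Proof.
move=> v1 c0 c'0 e0 cc'e dlt0 mdlt cm.
have bB : borel (ball (c *: v) e) by apply: borel_open; exact: ball_open.
have sv1 : sqnorm v = 1 by rewrite -sqr_enorm2 v1 expr1n.
rewrite !projection_law//=.
have ct0 : 0 < c / tau by rewrite divr_gt0.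
apply: le_trans (lerB (half_tail_ge haar_muA i0 sv1 dlt0 ct0 mdlt cm) (lexx _)) _.
have mU : measurable ([set M : 'M[R]_(n, k) | c / tau <= (M *m v) i0 0] : set (borelType _)).
  exact: coord_ge_borel.
have mT : measurable ([set M : 'M[R]_(n, k) |
    c' <= enorm2 (tau *: (M^T *m delta_mx i0 0))] : set (borelType _)).
  by rewrite tail_set ?(ltW c'0)//; exact: row_gram_ge_borel.
apply: le_trans (fine_probD_ge muA mU mT) _.
apply: le_fine_prob; first exact: measurableD.
  apply: (random_element_preimage (T := borelType 'M[R]_(n, k)) _ bB).
  apply: measurable_scalemx; first exact: measurable_cst.
  apply: measurable_mulmx; last exact: measurable_cst.
  by apply: measurable_trmx; exact: random_element_id.
move=> M [/= cU /negP]; rewrite -ltNge => Yc'; split => // i j.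
rewrite ord1 -ball_normE /=.
set z := tau *: (M^T *m delta_mx i0 0) in Yc' *.
have U : c <= \sum_l z l 0 * v l 0.
  have -> : \sum_l z l 0 * v l 0 = tau * (M *m v) i0 0.
    rewrite mxE mulr_sumr; apply: eq_bigr => l _.
    by rewrite /z mxE -colE !mxE mulrA.
  by rewrite mulrC -ler_pdivrMr.
have dist : sqnorm (c *: v - z) = c ^+ 2 - 2 * c * (\sum_l z l 0 * v l 0) + sqnorm z.
  transitivity (c ^+ 2 * sqnorm v - 2 * c * (\sum_l z l 0 * v l 0) + sqnorm z).
    rewrite /sqnorm !mulr_sumr -sumrB -big_split /=; apply: eq_bigr => l _.
    by rewrite !mxE; ring.
  by rewrite sv1 mulr1.
have z2 : sqnorm z < c' ^+ 2.
  by rewrite -sqr_enorm2 ltrXn2r ?nnegrE ?enorm2_ge0 ?(ltW c'0).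
have dist_lt : sqnorm (c *: v - z) < e ^+ 2.
  have := ler_wpM2l (ltW c0) U; rewrite dist; nra.
have := enorm2_coord (c *: v - z) i; rewrite !mxE => /le_lt_trans; apply.
by rewrite -(ltr_pXn2r (n := 2)) ?nnegrE ?enorm2_ge0 ?(ltW e0)// sqr_enorm2.
Qed.

End projection.

Lemma tilted_meanE (R : realType) (n m : nat) : (0 < n)%N ->
  1 - tilted_mean R n m = (n%:R - 1) / (n%:R + 2 * m.+1%:R).
Proof.
move=> n0; rewrite /tilted_mean !natrD !natrM.
have m0 : 0 <= m.+1%:R :> R by [].
have n1 : 1 <= n%:R :> R by rewrite ler1n.
by field; rewrite -natr1; apply/eqP; move: m0; rewrite -natr1; lra.
Qed.

Section tilted_growth.
Context {R : realType} {s : nat -> R}.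
Hypothesis s_oo : s n @[n --> \oo] --> +oo.
Variables (al dlt : R).
Hypothesis al0 : 0 < al.
Hypothesis dlt0 : 0 < dlt.

Let m n := Num.trunc (al * s n).

Lemma trunc_large : \forall n \near \oo, 4 <= (2 * (m n).+1 + 1)%:R * dlt ^+ 2.
Proof.
have sN := near_s_ge s_oo (2 / (al * dlt ^+ 2)).
near=> n; have : 2 / (al * dlt ^+ 2) <= s n by near: n.
have d2 : 0 < dlt ^+ 2 by rewrite exprn_gt0.
rewrite ler_pdivrMr ?mulr_gt0// => h.
have am : al * s n <= (m n).+1%:R by apply/ltW; exact: truncnS_gt.
have := ler_wpM2r (ltW d2) am; rewrite natrD natrM; nra.
Unshelve. all: by end_near. Qed.

(** The factor 8 (m + 1) is bounded by an affine function of s, hence invisible on the exponential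
    scale, while (1 + dlt)^(m+1) <= exp (dlt (al s + 1)) costs al dlt in the rate. *)
Lemma tilted_growth (y : R) :
  growth s (fun n => (1 - tilted_mean R n (m n)) ^+ (n./2).+1) y ->
  growth s (fun n => (1 - tilted_mean R n (m n)) ^+ (n./2).+1 /
    (8 * (m n).+1%:R * (1 + dlt) ^+ (m n).+1)) (y + al * dlt).
Proof.
move=> gy.
have a8 : 0 < 8 * al by rewrite mulr_gt0.
have g1 := growth_inv_affine (b := 8) s_oo a8 (ltr0Sn R 7).
have g2 := growth_cst s_oo (expR_gt0 (- dlt)).
have g3 := growth_expR (L := al * dlt) s_oo.
have g := growthM gy (growthM g1 (growthM g2 g3)).
have s0 := near_s_ge s_oo 0.
apply: growth_le g; last by rewrite !add0r.
near=> n; have sn0 : 0 <= s n by near: n.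
have n0 : (0 < n)%N by near: n; exists 1%N.
have mle : (m n).+1%:R <= al * s n + 1.
  by rewrite -natr1 lerD2r truncn_le// mulr_ge0// ltW.
apply: ler_wpM2l.
  by rewrite exprn_ge0// tilted_meanE// divr_ge0 ?subr_ge0 ?ler1n.
rewrite invfM ler_pM ?mulr_ge0 ?expR_ge0 ?invr_ge0//; first by nra.
- have p0 : 0 <= al * s n by rewrite mulr_ge0// ltW.
  have p1 : 0 < 8 * al * s n + 8 by lra.
  rewrite lef_pV2 ?posrE ?mulr_gt0// ?p1//.
  by rewrite -mulrA -[X in _ + X]mulr1 -mulrDr ler_wpM2l.
- have d1 : 0 < 1 + dlt by rewrite addr_gt0.
  rewrite -expRD -opprD expRN lef_pV2 ?posrE ?expR_gt0 ?exprn_gt0//.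
  apply: (@le_trans _ _ (expR dlt ^+ (m n).+1)).
    by rewrite lerXn2r ?nnegrE ?expR_ge0 ?expR_ge1Dx//; lra.
  by rewrite -expRM_natr ler_expR; have := ler_wpM2l (ltW dlt0) mle; lra.
Unshelve. all: by end_near. Qed.

End tilted_growth.

(** * From the radial LDP to the projected one *)

(** [direction] needs an index, absent for n = 0; the value there is a placeholder, excluded by 0 <
    k <= n. *)
Definition unit_direction (R : realType) (n : nat) : 'cV[R]_n -> 'cV[R]_n :=
  if n is n'.+1 then direction ord0 else id.

Section stiefel_LDP.
Context {R : realType} {k : nat} {d : nat -> measure_display}
  {T : forall n, measurableType (d n)}.
Variables (P : forall n, probability (T n) R)
  (X : forall n, T n -> 'cV[R]_n) (A : forall n, T n -> 'M[R]_(n, k))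
  (s r tau : nat -> R) (J : R -> \bar R) (g : R -> R).
Hypothesis k0 : (0 < k)%N.
Hypothesis mX : forall n, (k <= n)%N -> random_element (@X n).
Hypothesis mA : forall n, (k <= n)%N -> random_element (@A n).
Hypothesis haarA : forall n, (k <= n)%N -> stiefel_haar (law (P n) (@A n)).
Hypothesis indAX : forall n, (k <= n)%N -> independent (P n) (@A n) (@X n).
Hypothesis s_gt0 : forall n, (k <= n)%N -> 0 < s n.
Hypothesis s_oo : s n @[n --> \oo] --> +oo.
Hypothesis r_ge0 : forall n, 0 <= r n.
Hypothesis tau_gt0 : forall n, (k <= n)%N -> 0 < tau n.
Hypothesis r_tau : forall n, (k <= n)%N -> r n * tau n = (Num.sqrt n%:R)^-1.
Hypothesis ldpJ : LDP_good P (fun n t => r n * enorm2 (@X n t)) s J.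
Hypothesis gP : cost_scale g.
Hypothesis g_right : forall y e : R, 0 < y -> 0 < e ->
  exists2 y', y < y' & g y' ^+ 2 - g y ^+ 2 <= e ^+ 2.
Hypothesis upper : forall y e : R, 0 < y -> 0 < e -> exists l : R,
  [/\ 0 < l < 1, \forall n \near \oo, l * (g y / tau n) ^+ 2 < 1 &
      decay s (fun n => ((1 - l) ^+ k)^-1 * (1 - l * (g y / tau n) ^+ 2) ^+ n./2)
        (y - e)].
Hypothesis lower : forall y e : R, 0 < y -> 0 < e -> exists al dlt : R,
  [/\ 0 < al, 0 < dlt,
      \forall n \near \oo,
        (g y / tau n) ^+ 2 <= (1 - dlt) * tilted_mean R n (Num.trunc (al * s n)) &
      growth s (fun n =>
        (1 - tilted_mean R n (Num.trunc (al * s n))) ^+ (n./2).+1) (y + e - al * dlt)].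

Let Z n (t : T n) : 'cV[R]_k := tau n *: ((A t)^T *m unit_direction (X t)).

Let near_k : \forall n \near \oo, (k <= n)%N. Proof. by exists k. Qed.

Let Z_random n : (k <= n)%N -> random_element (@Z n).
Proof.
case: n => [|n] kn; first by have := leq_trans k0 kn.
have H := random_projection ord0 (mX kn) (mA kn) (tau n.+1).
exact: H.
Qed.

Let Z_decay (y : R) : 0 < y ->
  decay s (fun n => fine (P n (@Z n @^-1` [set z | g y <= enorm2 z]))) y.
Proof.
move=> y0; apply: decay_sup => e e0; have [l [l01 l1 dec]] := upper y0 e0.
apply: decay_le dec => //.
have gy : 0 <= g y by rewrite -(cost_scale0 gP) ltW// cost_scale_lt.
apply: filterS3 near_k (nbhs_infty_ge 2) l1 => -[//|n] kn n2 ln.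
have H := projection_tail_le ord0 (mX kn) (mA kn) (haarA kn) (indAX kn) (tau_gt0 kn)
  k0 n2 l01 gy ln.
exact: H.
Qed.

Let Z_growth (y e : R) (v : 'cV[R]_k) : 0 < y -> 0 < e -> enorm2 v = 1 ->
  growth s (fun n => fine (P n (@Z n @^-1` ball (g y *: v) e))) y.
Proof.
move=> y0 e0 v1; have [y' yy' gyy'] := g_right y0 e0.
have y'0 : 0 < y' by exact: lt_trans yy'.
have g_gt0 w : 0 < w -> 0 < g w.
  by move=> w0; rewrite -(cost_scale0 gP) cost_scale_lt.
(* The slack f' is kept below y' - y, so that the growth rate y + f' stays under the decay rate y'
   of the subtracted event. *)
apply: growth_inf => f f0; pose f' := Num.min f ((y' - y) / 2).
have f'0 : 0 < f' by rewrite lt_min f0 divr_gt0// subr_gt0.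
have f'f : f' <= f by rewrite ge_min lexx.
have f'y : y + f' < y'.
  have : f' <= (y' - y) / 2 by rewrite ge_min lexx orbT.
  by lra.
have [al [dlt [al0 dlt0 mean_ge gr]]] := lower y0 f'0.
have {gr} := tilted_growth s_oo al0 dlt0 gr; rewrite subrK => gr.
have := decay_growth_sub s_oo f'y gr (Z_decay y'0).
apply: growth_le; last by rewrite lerD2l.
have large := trunc_large s_oo al0 dlt0.
apply: filterS3 near_k mean_ge large => -[|n] kn mn ln.
  by have := leq_trans k0 kn.
have H := projection_ball_ge ord0 (mX kn) (mA kn) (haarA kn) (indAX kn) (tau_gt0 kn)
  v1 (g_gt0 _ y0) (g_gt0 _ y'0) e0 gyy' dlt0 ln mn.
exact: H.
Qed.

Lemma stiefel_LDP :
  LDP_good P (fun n t => (Num.sqrt n%:R)^-1 *: ((A t)^T *m @X n t)) s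
    (radial_rate (k := k) J g).
Proof.
apply: (product_LDP (N0 := k) (rho := fun n t => r n * enorm2 (@X n t)) (Z := @Z)) => //.
- by move=> n kn; apply: measurable_funM => //; exact: measurable_enorm2 (mX kn).
- by move=> n t; rewrite mulr_ge0// enorm2_ge0.
- case=> [|n] kn t; first by have := leq_trans k0 kn.
  rewrite /Z scalerA -mulrA (mulrC (enorm2 _)) mulrA r_tau//.
  rewrite -scalerA; congr (_ *: _); rewrite /unit_direction /=.
  by rewrite scalemxAr enorm2_direction.
- case=> [|n] kn B C mB bC; first by have := leq_trans k0 kn.
  apply: (projection_radius_indep ord0 (mX kn) (mA kn) (haarA kn) (indAX kn) (tau n.+1)
    (f := fun x => r n.+1 * enorm2 x)) => //.
  have mf : measurable_fun setT
      (fun x : borelType 'cV[R]_n.+1 => r n.+1 * enorm2 (x : 'cV[R]_n.+1)).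
    apply: measurable_funM => //; apply: measurable_enorm2; exact: measurable_id.
  by rewrite -[X in borel X]setTI; exact: mf.
Qed.

End stiefel_LDP.

(** * The cost scales of the two regimes *)

Definition scale_Astar (R : realType) (y : R) : R := Num.sqrt (1 - expR (- (2 * y))).

Definition scale_B (R : realType) (y : R) : R := Num.sqrt (2 * y).

Section scales.
Context {R : realType}.
Implicit Types y c : R.

Lemma sqr_scale_Astar y : 0 <= y -> scale_Astar y ^+ 2 = 1 - expR (- (2 * y)).
Proof.
by move=> y0; rewrite sqr_sqrtr// subr_ge0 expR_le1 oppr_le0 mulr_ge0.
Qed.

Lemma sqr_scale_B y : 0 <= y -> scale_B y ^+ 2 = 2 * y.
Proof. by move=> y0; rewrite sqr_sqrtr// mulr_ge0. Qed.

Lemma scale_Astar_onto c : 0 < c < 1 ->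
  scale_Astar (- (2^-1 * ln (1 - c ^+ 2))) = c.
Proof.
move=> /andP[c0 c1]; rewrite /scale_Astar mulrN opprK mulrA mulfV// mul1r lnK.
  by rewrite subKr sqrtr_sqr ger0_norm// ltW.
by rewrite posrE subr_gt0 expr_lt1// ltW.
Qed.

Lemma scale_Astar_lt1 y : scale_Astar y < 1.
Proof.
by rewrite -sqrtr1 ltr_sqrt ?ltr01// gtrBl expR_gt0.
Qed.

Lemma scale_Astar_lt y y' : 0 <= y -> y < y' -> scale_Astar y < scale_Astar y'.
Proof.
move=> y0 yy'; rewrite ltr_sqrt; last first.
  by rewrite subr_gt0 expR_lt1 oppr_lt0 mulr_gt0//; exact: le_lt_trans yy'.
by rewrite ltrD2l ltrN2 ltr_expR ltrN2 ltr_pM2l.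
Qed.

Lemma ln_1Bsqr_scale_Astar y : 0 <= y ->
  - (2^-1 * ln (1 - scale_Astar y ^+ 2)) = y.
Proof. by move=> y0; rewrite sqr_scale_Astar// subKr expRK mulrN opprK mulKf. Qed.

Lemma cost_scale_Astar : cost_scale (@scale_Astar R).
Proof.
split.
- by rewrite /scale_Astar mulr0 oppr0 expR0 subrr sqrtr0.
- exact: scale_Astar_lt.
- move=> c y c0 y0 cy; have c1 : c < 1 by exact: le_lt_trans cy (scale_Astar_lt1 y).
  exists (- (2^-1 * ln (1 - c ^+ 2))); last by rewrite scale_Astar_onto// c0.
  have c2 : c ^+ 2 <= 1 - expR (- (2 * y)).
    by rewrite -sqr_scale_Astar ?(ltW y0)// ler_pXn2r ?nnegrE ?sqrtr_ge0 ?(ltW c0).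
  have c21 : 0 < 1 - c ^+ 2 by rewrite subr_gt0 expr_lt1// ltW.
  have c20 : 0 < c ^+ 2 by rewrite exprn_gt0.
  have l0 : ln (1 - c ^+ 2) < 0 by rewrite ln_lt0// c21 gtrBl.
  have ly : - (2 * y) <= ln (1 - c ^+ 2).
    by rewrite -(expRK (- (2 * y))) ler_ln ?posrE ?expR_gt0//; lra.
  by apply/andP; split; lra.
(* With x = exp (- 2 y) and b = exp (- 2 e), the squared claim is (1 + a) (1 - x) <= 1 - x b. As x
   >= exp (- 2 L), this a is at most x (1 - b), which is enough. *)
- move=> L e L0 e0; pose a : R := expR (- (2 * L)) * (1 - expR (- (2 * e))).
  have a0 : 0 < a by rewrite mulr_gt0 ?expR_gt0// subr_gt0 expR_lt1 oppr_lt0 mulr_gt0.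
  exists (Num.sqrt (1 + a)); first by rewrite -[ltLHS]sqrtr1 ltr_sqrt; lra.
  move=> y /andP[y0 yL]; rewrite /scale_Astar -sqrtrM; last by lra.
  rewrite ler_wsqrtr// (mulrDr 2) opprD expRD.
  have xL : expR (- (2 * L)) <= expR (- (2 * y)) by rewrite ler_expR lerN2 ler_pM2l// ltW.
  have b1 : 0 <= 1 - expR (- (2 * e)) by rewrite subr_ge0 expR_le1 oppr_le0 mulr_ge0// ltW.
  have := ler_wpM2r b1 xL; rewrite -/a => ax.
  have : 0 <= a * expR (- (2 * y)) by rewrite mulr_ge0 ?expR_ge0// ltW.
  move: ax; clearbody a; move: (expR (- (2 * y))) (expR (- (2 * e))) => x b.
  by nra.
Qed.

Lemma scale_B_onto c : 0 < c -> scale_B (c ^+ 2 / 2) = c.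
Proof. by move=> c0; rewrite /scale_B mulrC divfK// sqrtr_sqr ger0_norm// ltW. Qed.

Lemma cost_scale_B : cost_scale (@scale_B R).
Proof.
split.
- by rewrite /scale_B mulr0 sqrtr0.
- by move=> y y' y0 yy'; rewrite ltr_sqrt ?ltr_pM2l// mulr_gt0//; exact: le_lt_trans yy'.
- move=> c y c0 y0 cy; exists (c ^+ 2 / 2); last exact: scale_B_onto.
  rewrite divr_gt0 ?exprn_gt0//= ler_pdivrMr// mulrC -sqr_scale_B ?(ltW y0)//.
  by rewrite ler_pXn2r ?nnegrE ?sqrtr_ge0 ?(ltW c0).
- move=> L e L0 e0.
  have eL : 0 < e / L by rewrite divr_gt0.
  exists (Num.sqrt (1 + e / L)); first by rewrite -[ltLHS]sqrtr1 ltr_sqrt; lra.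
  move=> y /andP[y0 yL]; rewrite /scale_B -sqrtrM; last by lra.
  rewrite ler_wsqrtr// mulrDl mul1r mulrDr lerD2l mulrCA ler_pM2l//.
  by rewrite mulrAC ler_pdivrMr// ler_pM2l// ltW.
Qed.

End scales.

Lemma radial_rate_Astar (R : realType) (k : nat) (J : R -> \bar R) :
  radial_rate (k := k) J (@scale_Astar R) = rate_Astar (k := k) J.
Proof.
apply/funext => x; rewrite /radial_rate /rate_Astar; case: ifPn => // _.
congr ereal_inf; apply/seteqP; split => _ [y /= y0 <-].
  exists (scale_Astar y).
    rewrite scale_Astar_lt1 andbT -(cost_scale0 (@cost_scale_Astar R)).
    exact: scale_Astar_lt.
  by rewrite ln_1Bsqr_scale_Astar// ltW.
exists (- (2^-1 * ln (1 - y ^+ 2))); last by rewrite scale_Astar_onto.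
have /andP[c0 c1] := y0; have y2 : 0 < y ^+ 2 by rewrite exprn_gt0.
have y21 : y ^+ 2 < 1 by rewrite expr_lt1// ltW.
have : ln (1 - y ^+ 2) < 0 by rewrite ln_lt0// subr_gt0 y21 gtrBl y2.
by rewrite /=; lra.
Qed.

Lemma radial_rate_B (R : realType) (k : nat) (J : R -> \bar R) :
  radial_rate (k := k) J (@scale_B R) = rate_B (k := k) J.
Proof.
apply/funext => x; rewrite /radial_rate /rate_B; case: ifPn => // _.
congr ereal_inf; apply/seteqP; split => _ [y /= y0 <-].
  exists (scale_B y); first by rewrite /= sqrtr_gt0 mulr_gt0.
  by rewrite sqr_scale_B ?(ltW y0)// [2 * y / 2]mulrAC mulfV// mul1r.
exists (y ^+ 2 / 2); first by rewrite /= divr_gt0// exprn_gt0.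
by rewrite scale_B_onto.
Qed.

(** * The two regimes *)

Section numeric_Astar.
Context {R : realType} {k : nat} {s : nat -> R}.
Hypothesis sE : forall n, (k <= n)%N -> s n = n%:R.

Lemma s_Astar_oo : s n @[n --> \oo] --> +oo.
Proof.
apply/cvgryPge => c; near=> n.
have kn : (k <= n)%N by near: n; exists k.
by rewrite sE//; near: n; exact: nbhs_infty_ger.
Unshelve. all: by end_near. Qed.

Lemma scale_Astar_right (y e : R) : 0 < y -> 0 < e ->
  exists2 y', y < y' & scale_Astar y' ^+ 2 - scale_Astar y ^+ 2 <= e ^+ 2.
Proof.
move=> y0 e0; exists (y + e ^+ 2 / 2); first by rewrite ltrDl divr_gt0// exprn_gt0.
have e2 : 0 <= e ^+ 2 by exact: sqr_ge0.
rewrite !sqr_scale_Astar; [|lra|lra].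
have -> : - (2 * (y + e ^+ 2 / 2)) = - (2 * y) + - e ^+ 2 by field.
rewrite expRD.
have x1 : expR (- (2 * y)) <= 1 by rewrite expR_le1; lra.
have x0 := expR_ge0 (- (2 * y)).
have b0 := expR_ge1Dx (- e ^+ 2).
have b1 : expR (- e ^+ 2) <= 1 by rewrite expR_le1; lra.
move: (expR (- (2 * y))) (expR (- e ^+ 2)) x1 x0 b0 b1 => x b x1 x0 b0 b1.
by nra.
Qed.

Lemma upper_Astar (y e : R) : 0 < y -> 0 < e -> exists l : R,
  [/\ 0 < l < 1, \forall n \near \oo, l * (scale_Astar y / 1) ^+ 2 < 1 &
      decay s (fun n => ((1 - l) ^+ k)^-1 * (1 - l * (scale_Astar y / 1) ^+ 2) ^+ n./2)
        (y - e)].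
Proof.
(* The rate is lowered to z < y so that the l chosen below is less than 1 and 1 - l (g y)^2 is
   exactly exp (- 2 z). The factor exp z in the final bound pays for rounding n / 2 down. *)
move=> y0 e0; pose z := y - Num.min e y / 2.
have m0 : 0 < Num.min e y by rewrite lt_min e0.
have me : Num.min e y <= e by rewrite ge_min lexx.
have my : Num.min e y <= y by rewrite ge_min lexx orbT.
have [z0 zy ez] : [/\ 0 < z, z < y & y - e <= z] by rewrite /z; split; lra.
have G0 : 0 < 1 - expR (- (2 * y)) by rewrite subr_gt0 expR_lt1 oppr_lt0 mulr_gt0.
have Gz : 0 < 1 - expR (- (2 * z)) by rewrite subr_gt0 expR_lt1 oppr_lt0 mulr_gt0.
have GzG : 1 - expR (- (2 * z)) < 1 - expR (- (2 * y)).
  by rewrite ltrD2l ltrN2 ltr_expR ltrN2 ltr_pM2l.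
pose l := (1 - expR (- (2 * z))) / (1 - expR (- (2 * y))).
have lG : l * (scale_Astar y / 1) ^+ 2 = 1 - expR (- (2 * z)).
  by rewrite divr1 sqr_scale_Astar ?(ltW y0)// /l divfK// gt_eqF.
have l01 : 0 < l < 1 by rewrite divr_gt0//= ltr_pdivrMr// mul1r.
exists l; split => //; first by apply: nearW => n; rewrite lG gtrBl expR_gt0.
have K0 : 0 < ((1 - l) ^+ k)^-1.
  by rewrite invr_gt0 exprn_gt0// subr_gt0; case/andP: l01.
have := decay_expR (K := ((1 - l) ^+ k)^-1 * expR z) (L := z) s_Astar_oo
  (mulr_gt0 K0 (expR_gt0 _)).
apply: decay_le => //; near=> n.
have kn : (k <= n)%N by near: n; exists k.
rewrite lG subKr sE// -mulrA ler_wpM2l ?(ltW K0)// -expRD -expRM_natr ler_expR.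
have : n%:R <= 2 * n./2%:R + 1 :> R.
  by rewrite -natrM natr1 ler_nat; clear; lia.
by nra.
Unshelve. all: by end_near. Qed.

Lemma lower_Astar (y e : R) : 0 < y -> 0 < e -> exists al dlt : R,
  [/\ 0 < al, 0 < dlt,
      \forall n \near \oo, (scale_Astar y / 1) ^+ 2 <=
        (1 - dlt) * tilted_mean R n (Num.trunc (al * s n)) &
      growth s (fun n =>
        (1 - tilted_mean R n (Num.trunc (al * s n))) ^+ (n./2).+1) (y + e - al * dlt)].
Proof.
move=> y0 e0; pose z := y + e / 2.
have [z0 yz] : 0 < z /\ y < z by rewrite /z; split; lra.
pose E := expR (2 * z).
have E1 : 1 < E by rewrite expR_gt1 mulr_gt0.
have E0 : 0 < E by exact: expR_gt0.
(* With m about al n the tilted mean tends to 2 al / (1 + 2 al) = 1 - 1 / E, so that (1 -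
   mean)^(n/2) is about exp (- n z). *)
pose al := (E - 1) / 2.
have al0 : 0 < al by rewrite /al; lra.
pose q : R := 1 - expR (- (2 * y)); pose q1 : R := 1 - E^-1.
have q0 : 0 < q by rewrite subr_gt0 expR_lt1 oppr_lt0 mulr_gt0.
have qq1 : q < q1 by rewrite /q /q1 /E -expRN ltrD2l ltrN2 ltr_expR ltrN2 ltr_pM2l.
have q10 : 0 < q1 by exact: lt_trans qq1.
have qr1 : q / q1 < 1 by rewrite ltr_pdivrMr ?mul1r.
(* The first bound keeps the cost al dlt of the concentration at most e / 2; the second keeps (1 -
   dlt) times the limiting mean at least (g y)^2. *)
pose dlt := Num.min (e / (2 * al)) (1 - q / q1).
have dlt0 : 0 < dlt.
  rewrite lt_min; apply/andP; split; first by rewrite divr_gt0// mulr_gt0.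
  by rewrite subr_gt0.
have dlt_e : al * dlt <= e / 2.
  rewrite mulrC -ler_pdivlMr// ge_min; apply/orP; left.
  by rewrite invfM mulrA.
have dlt_q : q <= (1 - dlt) * q1.
  by rewrite -ler_pdivrMr// lerBrDr -lerBrDl ge_min lexx orbT.
have dlt1 : dlt < 1.
  by rewrite gt_min; apply/orP; right; rewrite gtrBl divr_gt0.
exists al, dlt; split => //.
- near=> n; have kn : (k <= n)%N by near: n; exists k.
  have n0 : (0 < n)%N by near: n; exists 1%N.
  rewrite divr1 sqr_scale_Astar ?(ltW y0)// -/q (le_trans dlt_q)// ler_wpM2l//.
    by rewrite subr_ge0 ltW.
  rewrite sE// -lerN2 -(lerD2l 1) tilted_meanE// /q1 subKr.
  have := ltW (truncnS_gt (al * n%:R)).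
  set M := (_.+1)%:R => aM.
  have n1 : 1 <= n%:R :> R by rewrite ler1n.
  rewrite ler_pdivrMr; last by nra.
  by rewrite mulrC ler_pdivlMr//; move: aM; rewrite /al; nra.
(* The exponent (2 z + 6 / n) (n / 2 + 1) exceeds n z by 2 z + 3 + 6 / n, which is at most 2 z + 4
   once n >= 6. *)
- have g1 := growth_cst s_Astar_oo (expR_gt0 (- (2 * z + 4))).
  have g2 := growth_expR (L := z) s_Astar_oo.
  apply: growth_le (growthM g1 g2); last first.
    by rewrite add0r /z; move: dlt_e; move: (al * dlt) => w; lra.
  near=> n; have kn : (k <= n)%N by near: n; exists k.
  have n6 : (6 <= n)%N by near: n; exists 6%N.
  have n0 : (0 < n)%N by exact: leq_trans n6.
  have n6R : 6 <= n%:R :> R by rewrite (ler_nat R 6).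
  have base : expR (- (2 * z + 6 / n%:R)) <= 1 - tilted_mean R n (Num.trunc (al * s n)).
    rewrite tilted_meanE// sE//.
    have : (Num.trunc (al * n%:R)).+1%:R <= al * n%:R + 1.
      by rewrite -natr1 lerD2r truncn_le// mulr_ge0// ltW.
    set M := (_.+1)%:R => Ma.
    have M0 : 0 <= M by [].
    rewrite opprD expRD [X in X * _]expRN -/E ler_pdivlMr; last by lra.
    have x_le : expR (- (6 / n%:R)) <= 1 - 3 / n%:R :> R.
      rewrite expRN -div1r ler_pdivrMr ?expR_gt0//.
      apply: le_trans (ler_wpM2l _ (expR_ge1Dx _)); last first.
        by rewrite subr_ge0 ler_pdivrMr; lra.
      have -> : 6 / n%:R = 2 * (3 / n%:R) :> R by rewrite mulrA -natrM.
      have : 3 / n%:R <= 2^-1 :> R by rewrite ler_pdivrMr; lra.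
      have : 0 < 3 / n%:R :> R by rewrite divr_gt0//; lra.
      by move: (3 / n%:R) => x; nra.
    apply: (@le_trans _ _ (E^-1 * (1 - 3 / n%:R) * (n%:R + 2 * M))).
      by rewrite ler_wpM2r ?ler_wpM2l ?invr_ge0 ?(ltW E0)//; lra.
    apply: (@le_trans _ _ (E^-1 * (1 - 3 / n%:R) * (E * n%:R + 2))).
      rewrite ler_wpM2l//; last by move: Ma; rewrite /al; lra.
      by rewrite mulr_ge0 ?invr_ge0 ?(ltW E0)// subr_ge0 ler_pdivrMr; lra.
    have -> : E^-1 * (1 - 3 / n%:R) * (E * n%:R + 2) =
        n%:R - 3 + (2 * E^-1 - 6 * E^-1 / n%:R) :> R.
      by field; rewrite !gt_eqF//; lra.
    have Ei : E^-1 <= 1 by rewrite invf_le1// ltW.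
    have : 0 <= 6 * E^-1 / n%:R by rewrite divr_ge0 ?mulr_ge0 ?invr_ge0 ?(ltW E0).
    by lra.
  have h_le : (n./2).+1%:R <= n%:R / 2 + 1 :> R.
    rewrite -natr1 lerD2r ler_pdivlMr// -natrM ler_nat; clear; lia.
  apply: le_trans (lerXn2r _ _ _ base); rewrite ?nnegrE ?expR_ge0//; last first.
    exact: le_trans base.
  rewrite -expRD -expRM_natr ler_expR sE//.
  have c0 : 0 <= 2 * z + 6 / n%:R.
    by rewrite addr_ge0 ?divr_ge0 ?mulr_ge0// ltW.
  have := ler_wpM2l c0 h_le.
  have -> : (2 * z + 6 / n%:R) * (n%:R / 2 + 1) = n%:R * z + 2 * z + 3 + 6 / n%:R :> R.
    by field; rewrite gt_eqF//; lra.
  have : 6 / n%:R <= 1 :> R by rewrite ler_pdivrMr; lra.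
  by lra.
Unshelve. all: by end_near. Qed.

End numeric_Astar.

Section numeric_B.
Context {R : realType} {k : nat} {s : nat -> R}.
Hypothesis k0 : (0 < k)%N.
Hypothesis s_gt0 : forall n, (k <= n)%N -> 0 < s n.
Hypothesis s_oo : s n @[n --> \oo] --> +oo.
Hypothesis ns_oo : n%:R / s n @[n --> \oo] --> +oo.

Let tau n := Num.sqrt (n%:R / s n).

Let sqr_scale_tau (y : R) n : 0 <= y -> (k <= n)%N ->
  (scale_B y / tau n) ^+ 2 = 2 * y * (s n / n%:R).
Proof.
move=> y0 kn; have sn := s_gt0 kn.
by rewrite expr_div_n sqr_scale_B// sqr_sqrtr ?divr_ge0 ?(ltW sn)// invf_div.
Qed.

Let s_small (c : R) : 0 < c -> \forall n \near \oo, c * s n <= n%:R.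
Proof.
move=> c0; have cs := near_s_ge ns_oo c; near=> n.
have kn : (k <= n)%N by near: n; exists k.
by rewrite -ler_pdivlMr ?s_gt0//; near: n.
Unshelve. all: by end_near. Qed.

Lemma scale_B_right (y e : R) : 0 < y -> 0 < e ->
  exists2 y', y < y' & scale_B y' ^+ 2 - scale_B y ^+ 2 <= e ^+ 2.
Proof.
move=> y0 e0; exists (y + e ^+ 2 / 2); first by rewrite ltrDl divr_gt0// exprn_gt0.
have e2 : 0 <= e ^+ 2 by exact: sqr_ge0.
by rewrite !sqr_scale_B; lra.
Qed.

Lemma upper_B (y e : R) : 0 < y -> 0 < e -> exists l : R,
  [/\ 0 < l < 1, \forall n \near \oo, l * (scale_B y / tau n) ^+ 2 < 1 &
      decay s (fun n => ((1 - l) ^+ k)^-1 * (1 - l * (scale_B y / tau n) ^+ 2) ^+ n./2)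
        (y - e)].
Proof.
(* This l satisfies l y >= y - e, and (1 - 2 l y s / n)^(n/2) <= exp (- l y s). *)
move=> y0 e0; pose l := 1 - Num.min (e / y) 1 / 2.
have m0 : 0 < Num.min (e / y) 1 by rewrite lt_min divr_gt0 //= ltr01.
have me : Num.min (e / y) 1 <= e / y by rewrite ge_min lexx.
have m1 : Num.min (e / y) 1 <= 1 by rewrite ge_min lexx orbT.
have l01 : 0 < l < 1 by rewrite /l; apply/andP; split; lra.
have [l0 l1] := andP l01.
have ely : y - e <= l * y.
  have : Num.min (e / y) 1 * y <= e by rewrite -ler_pdivlMr.
  by rewrite /l; nra.
have small : \forall n \near \oo, l * (scale_B y / tau n) ^+ 2 < 1.
  have sm := @s_small (2 * y) (mulr_gt0 (ltr0Sn R 1) y0).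
  near=> n; have kn : (k <= n)%N by near: n; exists k.
  have n0 : 0 < n%:R :> R by rewrite ltr0n (leq_trans k0).
  rewrite sqr_scale_tau ?(ltW y0)//; apply: le_lt_trans l1.
  rewrite -[leRHS]mulr1 ler_wpM2l ?(ltW l0)// mulrA ler_pdivrMr// mul1r.
  by near: n.
exists l; split => //.
have K0 : 0 < ((1 - l) ^+ k)^-1 by rewrite invr_gt0 exprn_gt0// subr_gt0.
have := decay_expR (K := ((1 - l) ^+ k)^-1 * expR (l * y)) (L := l * y) s_oo
  (mulr_gt0 K0 (expR_gt0 _)).
have sm1 := s_small (ltr01 : 0 < 1 :> R).
apply: decay_le => //; near=> n.
have kn : (k <= n)%N by near: n; exists k.
have n0 : 0 < n%:R :> R by rewrite ltr0n (leq_trans k0).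
rewrite -mulrA ler_wpM2l ?(ltW K0)// -expRD.
have base : 1 - l * (scale_B y / tau n) ^+ 2 <= expR (- (l * (scale_B y / tau n) ^+ 2)).
  exact: expR_ge1Dx.
apply: le_trans (lerXn2r _ _ _ base) _; rewrite ?nnegrE ?expR_ge0//.
  by rewrite subr_ge0 ltW//; near: n.
rewrite -expRM_natr ler_expR sqr_scale_tau ?(ltW y0)//.
have nh : n%:R <= 2 * n./2%:R + 1 :> R.
  by rewrite -natrM natr1 ler_nat; clear; lia.
have ly0 : 0 <= l * y by rewrite mulr_ge0// ltW.
have q0 : 0 <= s n / n%:R by rewrite divr_ge0// ltW// s_gt0.
have sn1 : 1 * s n <= n%:R by near: n.
have q1 : s n / n%:R <= 1 by rewrite ler_pdivrMr// mul1r -[s n]mul1r.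
have sE : s n = s n / n%:R * n%:R by rewrite divfK// gt_eqF.
rewrite {2}sE -(mulrA 2) mulrCA (mulrA l); move: (l * y) (s n / n%:R) (n./2%:R) ly0 q0 q1 nh.
move=> w q h w0 q0 q1 nh.
have := ler_wpM2l (mulr_ge0 w0 q0) nh; have := ler_wpM2l w0 q1; nra.
Unshelve. all: by end_near. Qed.

Lemma lower_B (y e : R) : 0 < y -> 0 < e -> exists al dlt : R,
  [/\ 0 < al, 0 < dlt,
      \forall n \near \oo, (scale_B y / tau n) ^+ 2 <=
        (1 - dlt) * tilted_mean R n (Num.trunc (al * s n)) &
      growth s (fun n =>
        (1 - tilted_mean R n (Num.trunc (al * s n))) ^+ (n./2).+1) (y + e - al * dlt)].
Proof.
(* As s / n tends to 0, the tilted mean is about 2 al s / n, to be compared with the level 2 y s /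
   n: any al > y reaches it, and (1 - mean)^(n/2) is about exp (- al s). *)
move=> y0 e0; pose al := y + e / 2.
have [al0 yal] : 0 < al /\ y < al by rewrite /al; split; lra.
pose dlt := Num.min (e / (2 * al)) ((1 - y / al) / 2).
have yal1 : y / al < 1 by rewrite ltr_pdivrMr ?mul1r.
have yal0 : 0 < y / al by rewrite divr_gt0.
have dlt0 : 0 < dlt.
  by rewrite lt_min !divr_gt0 ?mulr_gt0// subr_gt0.
have dlt_e : al * dlt <= e / 2.
  rewrite mulrC -ler_pdivlMr// ge_min; apply/orP; left.
  by rewrite invfM mulrA.
have dlt_y : dlt <= (1 - y / al) / 2 by rewrite ge_min lexx orbT.
have dlt1 : 0 <= 1 - dlt by lra.
have kap0 : 0 < (1 - dlt) * al - y.
  have : y / al * al = y by rewrite divfK// gt_eqF.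
  by move: dlt_y yal0 yal1; move: (y / al) => w; nra.
move: dlt dlt0 dlt_e dlt1 kap0 {dlt_y} => dlt dlt0 dlt_e dlt1 kap0.
exists al, dlt; split => //.
(* The requirement 2 y s / n <= (1 - dlt) 2 al s / (n + 2 al s) amounts to 2 y al s <= n ((1 - dlt)
   al - y). *)
- have c0 : 0 < 2 * y * al / ((1 - dlt) * al - y) by rewrite divr_gt0 ?mulr_gt0.
  have sm := s_small c0.
  near=> n; have kn : (k <= n)%N by near: n; exists k.
  have n0 : (0 < n)%N by exact: leq_trans kn.
  have nR0 : 0 < n%:R :> R by rewrite ltr0n.
  have sn := s_gt0 kn.
  have sns : 2 * y * al / ((1 - dlt) * al - y) * s n <= n%:R by near: n.
  rewrite sqr_scale_tau ?(ltW y0)//.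
  apply: (@le_trans _ _ ((1 - dlt) * (2 * al * s n / (n%:R + 2 * al * s n)))).
    have D0 : 0 < n%:R + 2 * al * s n by rewrite addr_gt0 ?mulr_gt0.
    rewrite [leLHS]mulrA [leRHS]mulrA ler_pdivrMr// [leRHS]mulrAC ler_pdivlMr//.
    have : 2 * y * al * s n <= n%:R * ((1 - dlt) * al - y).
      by rewrite -ler_pdivrMr// mulrAC.
    move=> /(ler_wpM2l (ltW sn)); nra.
  rewrite ler_wpM2l// -lerN2 -(lerD2l 1) tilted_meanE//.
  have := ltW (truncnS_gt (al * s n)).
  set M := (_.+1)%:R => aM.
  have as0 : 0 < al * s n by rewrite mulr_gt0.
  have -> : 1 - 2 * al * s n / (n%:R + 2 * al * s n) = n%:R / (n%:R + 2 * al * s n) :> R.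
    by field; rewrite gt_eqF//; lra.
  rewrite ler_pdivrMr; last by lra.
  rewrite mulrAC ler_pdivlMr; last by lra.
  by nra.
(* Here 1 / (1 - mean) = 1 + (1 + 2 (m + 1)) / (n - 1) with m <= al s. In the power n / 2 + 1, the
   exponent exceeds al s by at most 6 al + 6 when n >= 2 and s <= n. *)
- have g1 := growth_cst s_oo (expR_gt0 (- (6 * al + 6))).
  have g2 := growth_expR (L := al) s_oo.
  have sm1 := s_small (ltr01 : 0 < 1 :> R).
  apply: growth_le (growthM g1 g2); last first.
    by rewrite add0r /al; move: dlt_e; rewrite /al; move: (_ * dlt) => w; lra.
  near=> n; have kn : (k <= n)%N by near: n; exists k.
  have n2 : (2 <= n)%N by near: n; exists 2%N.
  have n0 : (0 < n)%N by exact: ltnW.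
  have nR2 : 2 <= n%:R :> R by rewrite (ler_nat R 2).
  have sn := s_gt0 kn.
  have sn1 : 1 * s n <= n%:R by near: n.
  have as0 : 0 < al * s n by rewrite mulr_gt0.
  have base : expR (- ((2 * (al * s n) + 3) / (n%:R - 1))) <=
      1 - tilted_mean R n (Num.trunc (al * s n)).
    rewrite tilted_meanE//.
    have : (Num.trunc (al * s n)).+1%:R <= al * s n + 1.
      by rewrite -natr1 lerD2r truncn_le// ltW.
    set M := (_.+1)%:R => Ma; have M0 : 0 <= M by [].
    rewrite -[leRHS]invf_div expRN lef_pV2 ?posrE ?expR_gt0 ?divr_gt0//; try lra.
    apply: le_trans (expR_ge1Dx _).
    rewrite ler_pdivrMr; last by lra.
    by rewrite [leRHS]mulrDl mul1r divfK ?gt_eqF//; lra.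
  have h_le : (n./2).+1%:R <= n%:R / 2 + 1 :> R.
    by rewrite -natr1 lerD2r ler_pdivlMr// -natrM ler_nat; clear; lia.
  apply: le_trans (lerXn2r _ _ _ base); rewrite ?nnegrE ?expR_ge0//; last first.
    exact: le_trans base.
  rewrite -expRD -expRM_natr ler_expR.
  have c0 : 0 <= (2 * (al * s n) + 3) / (n%:R - 1) by rewrite divr_ge0; lra.
  have := ler_wpM2l c0 h_le.
  have : (2 * (al * s n) + 3) / (n%:R - 1) * (n%:R / 2 + 1) <=
      6 * al + 6 + al * s n.
    rewrite mulrAC ler_pdivrMr; last by lra.
    have := ler_wpM2l (ltW al0) sn1; nra.
  by lra.
Unshelve. all: by end_near. Qed.

End numeric_B.

Theorem theorem2p7 (R : realType) (k : nat) (hk : (0 < k)%N)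
    (d : nat -> measure_display) (T : forall n, measurableType (d n))
    (P : forall n, probability (T n) R)
    (X : forall n, T n -> 'cV[R]_n)
    (A : forall n, T n -> 'M[R]_(n, k))
    (mX : forall n, (k <= n)%N -> random_element (X n))
    (mA : forall n, (k <= n)%N -> random_element (A n))
    (haarA : forall n, (k <= n)%N -> stiefel_haar (law (P n) (A n)))
    (indAX : forall n, (k <= n)%N -> independent (P n) (A n) (X n))
    (s : nat -> R) (s_gt0 : forall n, (k <= n)%N -> 0 < s n)
    (J : R -> \bar R) :
  let eta n (t : T n) : 'cV[R]_k :=
    (Num.sqrt n%:R)^-1 *: ((A n t)^T *m X n t) in
  (assumption_Astar k P X s J ->
     LDP_good P eta s (rate_Astar (k := k) J)) /\
  (assumption_B P X s J ->
     LDP_good P eta s (rate_B (k := k) J)).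
Proof.
move=> eta; split.
- case=> sE ldp; rewrite -radial_rate_Astar.
  have s_oo := s_Astar_oo sE.
  (* In both regimes n^(-1/2) = r tau, where [r] is the scaling of |X| in the assumed LDP and [tau]
     is what is left for the direction. *)
  apply: (stiefel_LDP (r := fun n => (Num.sqrt n%:R)^-1) (tau := fun=> 1)) => //.
  + by move=> n _; rewrite mulr1.
  + have -> // : (fun n t => (Num.sqrt n%:R)^-1 * enorm2 (X n t)) =
      (fun n t => enorm2 (X n t) / Num.sqrt n%:R).
    by apply: functional_extensionality_dep => n; apply/funext => t; rewrite mulrC.
  + exact: cost_scale_Astar.
  + exact: scale_Astar_right.
  + exact: upper_Astar sE.
  + exact: lower_Astar sE.
- case=> s_oo ns_oo ldp; rewrite -radial_rate_B.
  have r_tau n : (k <= n)%N ->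
      Num.sqrt (s n) / n%:R * Num.sqrt (n%:R / s n) = (Num.sqrt n%:R)^-1.
    move=> kn; have sn := s_gt0 n kn.
    have n0 : 0 < n%:R :> R by rewrite ltr0n (leq_trans hk).
    rewrite sqrtrM ?(ltW n0)// sqrtrV ?(ltW sn)//.
    rewrite -{1}(sqr_sqrtr (ltW n0)); field.
    by rewrite !gt_eqF ?sqrtr_gt0.
  apply: (stiefel_LDP (r := fun n => Num.sqrt (s n) / n%:R)
    (tau := fun n => Num.sqrt (n%:R / s n))) => //.
  + by move=> n kn; rewrite sqrtr_gt0 divr_gt0 ?s_gt0// ltr0n (leq_trans hk).
  + have -> // : (fun n t => Num.sqrt (s n) / n%:R * enorm2 (X n t)) =
      (fun n t => Num.sqrt (s n) * enorm2 (X n t) / n%:R).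
    by apply: functional_extensionality_dep => n; apply/funext => t; rewrite mulrAC.
  + exact: cost_scale_B.
  + exact: scale_B_right.
  + exact: (upper_B hk).
  + exact: (lower_B hk).
Qed.
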